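(* Let $1\le q<\infty$. A quasi-Banach sequence lattice $E$ has the $S_q$-property if and only if $E\in Int(\ell^p,\ell^q)$ for some $p\in(0,q)$.
   Context: All sequences are real. $\|x\|_{\ell^p}=(\sum_k|x_k|^p)^{1/p}$ for $0<p<\infty$. For a bounded sequence $u$, $(u_k^* )$ is the nonincreasing rearrangement of $(|u_k|)$: $u_k^*:=\inf_{\mathrm{card}A=k-1}\sup_{i\in\mathbb{N}\setminus A}|u_i|$. A quasi-Banach sequence lattice is a quasi-Banach space $E$ of real sequences such that $|y_k|\le|x_k|$ for all $k$ and $(x_k)\in E$ imply $(y_k)\in E$ and $\|(y_k)\|_E\le\|(x_k)\|_E$. $S_q$-property: $E\ne\{0\}$, $E\subseteq\ell^q$, and there is a constant $C$ such that whenever $x\in E$ and $y\in\ell^q$ satisfy $\sum_{n=1}^\infty|x_n|^q=\sum_{n=1}^\infty|y_n|^q$ and $\sum_{n=1}^m(x_n^* )^q\le\sum_{n=1}^m(y_n^* )^q$ for all $m\in\mathbb{N}$, it follows that $y\in E$ and $\|y\|_E\le C\|x\|_E$. For $0<p<q$, $Int(\ell^p,\ell^q)$ is the class of all quasi-Banach spaces $E$ with continuous inclusions $\ell^p\subset E\subset\ell^q$ such that every bounded linear operator $T$ on $\ell^q$ whose restriction to $\ell^p$ is bounded from $\ell^p$ to $\ell^p$ maps $E$ boundedly into $E$. *)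

(* Defs.v *)
From HB Require Import structures.
From mathcomp Require Import all_boot all_order all_algebra.
From mathcomp Require Import all_classical all_reals all_analysis.

Set Implicit Arguments.
Unset Strict Implicit.
Unset Printing Implicit Defensive.

Import Order.TTheory GRing.Theory Num.Theory.
Import numFieldNormedType.Exports.

Local Open Scope classical_set_scope.
Local Open Scope ring_scope.

(* Sequences are indexed from 0: the k-th term here is the (k+1)-st term in
   the usual 1-based convention. *)

(* A set of real sequences with a candidate quasi-norm; the values of [qnorm]
   outside [carrier] are irrelevant. *)
Record seq_space (R : realType) := SeqSpace {
  carrier : set (nat -> R);
  qnorm : (nat -> R) -> R }.

Record quasi_banach (R : realType) (E : seq_space R) : Prop := QuasiBanach {
  qb_zero : carrier E 0;
  qb_linear : forall (a : R) (x y : nat -> R),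
    carrier E x -> carrier E y -> carrier E (a *: x + y);
  qb_ge0 : forall x : nat -> R, carrier E x -> 0 <= qnorm E x;
  qb_eq0 : forall x : nat -> R, carrier E x -> qnorm E x = 0 -> x = 0;
  qb_homogeneous : forall (a : R) (x : nat -> R),
    carrier E x -> qnorm E (a *: x) = `|a| * qnorm E x;
  qb_quasi_triangle : exists K : R, forall x y : nat -> R,
    carrier E x -> carrier E y ->
    qnorm E (x + y) <= K * (qnorm E x + qnorm E y);
  qb_complete : forall u : nat -> (nat -> R),
    (forall n, carrier E (u n)) ->
    (forall e : R, 0 < e -> exists N : nat, forall m n : nat,
      (N <= m)%N -> (N <= n)%N -> qnorm E (u m - u n) < e) ->
    exists2 x : nat -> R, carrier E x &
      qnorm E (u n - x) @[n --> \oo] --> (0 : R) }.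

Record quasi_banach_lattice (R : realType) (E : seq_space R) : Prop :=
  QuasiBanachLattice {
  qbl_quasi_banach : quasi_banach E;
  qbl_solid : forall x y : nat -> R,
    (forall k, `|y k| <= `|x k|) -> carrier E x ->
    carrier E y /\ qnorm E y <= qnorm E x }.

Definition ell_norm (R : realType) (p : R) (x : nat -> R) : \bar R :=
  ((\sum_(0 <= k <oo) (`|x k| `^ p)%:E) `^ p^-1)%E.

Definition ell (R : realType) (p : R) : seq_space R :=
  SeqSpace [set x | (ell_norm p x < +oo)%E] (fun x => fine (ell_norm p x)).

(* Nonincreasing rearrangement, meaningful for bounded [u]. *)
Definition rearr (R : realType) (u : nat -> R) (k : nat) : R :=
  inf [set sup [set `|u i| | i in ~` A] | A in [set A : set nat | (A #= `I_k)%card]].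

Definition Sq_property (R : realType) (q : R) (E : seq_space R) : Prop :=
  [/\ carrier E <> [set 0],
      carrier E `<=` carrier (ell q) &
      exists C : R, forall x y : nat -> R,
        carrier E x -> carrier (ell q) y ->
        (\sum_(0 <= n <oo) (`|x n| `^ q)%:E =
         \sum_(0 <= n <oo) (`|y n| `^ q)%:E)%E ->
        (forall m : nat, \sum_(0 <= n < m) rearr x n `^ q <=
                         \sum_(0 <= n < m) rearr y n `^ q) ->
        carrier E y /\ qnorm E y <= C * qnorm E x].

(* Continuity for the topologies in which the balls of the quasi-norm around
   each point form a base of neighbourhoods of that point. *)
Definition continuous_inclusion (R : realType) (E F : seq_space R) : Prop :=
  carrier E `<=` carrier F /\
  forall x : nat -> R, carrier E x -> forall e : R, 0 < e ->
    exists2 d : R, 0 < d & forall y : nat -> R, carrier E y ->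
      qnorm E (y - x) < d -> qnorm F (y - x) < e.

Definition linear_on (R : realType) (E : seq_space R)
    (T : (nat -> R) -> (nat -> R)) : Prop :=
  forall (a : R) (x y : nat -> R), carrier E x -> carrier E y ->
    T (a *: x + y) = a *: T x + T y.

Definition bounded_on (R : realType) (E : seq_space R)
    (T : (nat -> R) -> (nat -> R)) : Prop :=
  exists M : R, forall x : nat -> R, carrier E x ->
    carrier E (T x) /\ qnorm E (T x) <= M * qnorm E x.

(* An operator on [ell q] is a total function of sequences whose values outside
   [ell q] are irrelevant. *)
Definition Int (R : realType) (p q : R) (E : seq_space R) : Prop :=
  [/\ quasi_banach E,
      continuous_inclusion (ell p) E,
      continuous_inclusion E (ell q) &
      forall T : (nat -> R) -> (nat -> R),
        linear_on (ell q) T -> bounded_on (ell q) T ->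
        bounded_on (ell p) T -> bounded_on E T].

(* Main.v *)
Require Import Defs.
From HB Require Import structures.
From mathcomp Require Import all_boot all_order all_algebra.
From mathcomp Require Import all_classical all_reals all_analysis.
From mathcomp Require Import ring lra zify.

Set Implicit Arguments.
Unset Strict Implicit.
Unset Printing Implicit Defensive.

Import Order.TTheory GRing.Theory Num.Theory.
Import numFieldNormedType.Exports.

Local Open Scope classical_set_scope.
Local Open Scope ring_scope.

(** The theorem says that, for some [p < q], the spaces between [l^p] and [l^q] that operators
    respect are those which are stable under making the [q]-th power tails
    [sum_(n >= m) (x^*_n)^q] smaller: since the two sums in the [S_q] condition agree, larger
    heads mean smaller tails.

    From interpolation to [S_q]. If the tails of [y] are below those of [x], an operator [T]
    with [T |x| >= |y|] can be written down. Where the [n]-th largest entry of [y] is at most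
    [2^(1/q)] times that of [x], [T] just multiplies by two. Elsewhere the mass [y_n^q] has to
    be collected from entries of [x]; the tail inequality provides disjoint intervals of
    indices, the [n]-th of which carries at least a quarter of [y_n^q] in the rearrangement of
    [x] ([tail_blocks]), and [T] sends such a block to the [n]-th place by the functional which
    is extremal for Hoelder's inequality at [x] ([block_operator]). As the blocks are disjoint,
    [T] is bounded on [l^r] for every [r <= q], with a bound depending on [r] alone. The
    constant of the [S_q] property must not depend on [x] and [y]. The operators are positive,
    so if no constant worked, the sum [S] of the operators [4^-j T_j] attached to worse and
    worse pairs would satisfy [4^j S |x_j| >= |y_j|]; boundedness of [S] on the lattice [E]
    contradicts the choice of the pairs ([Int_Sq]).

    From [S_q] to interpolation. The [S_q] property bounds the quasi-norm of [y] as soon as, for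
    each [m], removing [m] entries from [y] leaves a sum of [q]-th powers below the [m]-th tail of
    a nonincreasing [w] in [E] ([Sq_transfer]). It also makes the dilation
    [w |-> (w_(n/2))_n] bounded on nonincreasing sequences, whence for a large integer [a] the
    series [z_n = sum_j 2^(-a j) w_(n / 2^j)] converges in [E] ([Sq_smear]). Take
    [p = 1 / (2 a)]. The [p]-mean of the first [m] entries of [w] is at most a constant times [z_m]
    ([smear_head]), and [m z_m^q] is at most the [m]-th tail of the dilation of [z] ([dil_tail]).
    If [T] is bounded on [l^p] and [l^q], split [x] into its [m] largest entries and the rest.
    Chebyshev's inequality in [l^p] controls the image of the first part off [m] places
    ([weak_off]), boundedness on [l^q] controls the second, and both bounds are tails of one
    element of [E]; so the transfer principle applies to [T x] ([Sq_split_transfer]). With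
    [w = (1, 0, 0, ...)] the same argument gives the inclusion of [l^p] in [E]. *)

(** * Sums of nonnegative sequences *)

(** Sums over duplicate-free lists, instead of initial segments, make the bound visibly invariant
    under a change of indices. *)
Definition sum_le {R : realType} (u : nat -> R) (B : R) : Prop :=
  forall s : seq nat, uniq s -> \sum_(i <- s) u i <= B.

Definition sums_to {R : realType} (u : nat -> R) (V : R) : Prop :=
  sum_le u V /\ forall B : R, sum_le u B -> V <= B.

Definition headsum {R : realType} (u : nat -> R) (m : nat) : R :=
  \sum_(0 <= k < m) u k.

Section Sums.
Context {R : realType}.
Implicit Types (u v : nat -> R) (B V : R).

Lemma ler_of_eq (a b : R) : a = b -> a <= b.
Proof. by move=> ->. Qed.

Lemma ler_sum_sub u (s t : seq nat) :
  (forall i, 0 <= u i) -> uniq s -> uniq t -> {subset s <= t} ->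
  \sum_(i <- s) u i <= \sum_(i <- t) u i.
Proof.
move=> u0 us ut st; rewrite [leRHS](bigID (mem s)) /=.
rewrite -[leLHS]addr0; apply: lerD; last by apply: sumr_ge0.
rewrite -[leRHS]big_filter; apply: ler_of_eq; apply: perm_big; apply: uniq_perm => //.
  exact: filter_uniq.
by move=> i; rewrite mem_filter; case: (boolP (i \in s)) => // /st ->.
Qed.

Lemma sum_leP u B : (forall i, 0 <= u i) ->
  sum_le u B <-> (forall n, headsum u n <= B).
Proof.
move=> u0; split=> [h n|h s us]; first by apply: h; apply: iota_uniq.
apply: le_trans (h (\max_(i <- s) i).+1); apply: ler_sum_sub => //.
  exact: iota_uniq.
move=> i si; rewrite mem_index_iota /= ltnS; exact: leq_bigmax_seq.
Qed.

Lemma sum_le_ge0 u B : sum_le u B -> 0 <= B.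
Proof. by move=> /(_ [::] isT); rewrite big_nil. Qed.

Lemma sum_le_term u B i : sum_le u B -> u i <= B.
Proof. by move=> /(_ [:: i] isT); rewrite big_seq1. Qed.

Lemma sum_le_trans u B B' : sum_le u B -> B <= B' -> sum_le u B'.
Proof. by move=> h BB s /h /le_trans; apply. Qed.

Lemma sum_le_mono u v B : (forall i, u i <= v i) -> sum_le v B -> sum_le u B.
Proof. by move=> uv h s /h; apply: le_trans; apply: ler_sum. Qed.

Lemma sum_leD u v B B' : sum_le u B -> sum_le v B' ->
  sum_le (fun i => u i + v i) (B + B').
Proof. by move=> h h' s us; rewrite big_split; apply: lerD; [exact: h|exact: h']. Qed.

Lemma sum_leZ u B c : 0 <= c -> sum_le u B -> sum_le (fun i => c * u i) (c * B).
Proof. by move=> c0 h s us; rewrite -mulr_sumr ler_wpM2l// h. Qed.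

Lemma sum_le_inj u B (f : nat -> nat) : injective f -> sum_le u B ->
  sum_le (u \o f) B.
Proof.
move=> fi h s us; rewrite -(big_map f xpredT u); apply: h.
by rewrite map_inj_uniq.
Qed.

Lemma sum_le_supp u B (f : nat -> nat) :
  (forall i, u i != 0 -> exists n, f n = i) -> sum_le (u \o f) B -> sum_le u B.
Proof.
move=> fs h s us.
have /choice[g gP] : forall i, exists n, u i != 0 -> f n = i.
  move=> i; have [u0|/fs[n <-]] := eqVneq (u i) 0; first by exists 0%N.
  by exists n.
rewrite (bigID (fun i => u i != 0)) /= [X in _ + X]big1 ?addr0; last first.
  by move=> i; rewrite negbK => /eqP.
rewrite -big_filter.
have -> : \sum_(i <- [seq i <- s | u i != 0]) u i =
    \sum_(i <- map g [seq i <- s | u i != 0]) (u \o f) i.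
  rewrite big_map; apply: eq_big_seq => i; rewrite mem_filter => /andP[ui _] /=.
  by rewrite gP.
apply: h; rewrite map_inj_in_uniq ?filter_uniq// => i j.
rewrite !mem_filter => /andP[ui _] /andP[uj _] e.
by rewrite -(gP _ ui) -(gP _ uj) e.
Qed.

Lemma sums_to_reindex u V (f : nat -> nat) : injective f ->
  (forall i, u i != 0 -> exists n, f n = i) ->
  sums_to u V -> sums_to (u \o f) V.
Proof.
move=> fi fs [h h']; split; first exact: sum_le_inj.
by move=> B hB; apply: h'; apply: sum_le_supp hB.
Qed.

Lemma nneseries_sum_le u B : (forall i, 0 <= u i) ->
  (\sum_(0 <= k <oo) (u k)%:E <= B%:E)%E <-> sum_le u B.
Proof.
move=> u0; rewrite sum_leP//; split=> [h n|h].
  rewrite -lee_fin; apply: le_trans h; rewrite /headsum -sumEFin.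
  by apply: nneseries_lim_ge => k _ _; rewrite lee_fin.
apply: lime_le; first by apply: is_cvg_nneseries => k _ _; rewrite lee_fin.
by apply: nearW => n; rewrite sumEFin lee_fin; exact: h.
Qed.

Lemma sums_toP u V : (forall i, 0 <= u i) ->
  sums_to u V <-> (\sum_(0 <= k <oo) (u k)%:E = V%:E)%E.
Proof.
move=> u0; split=> [[h h']|h].
  apply/eqP; rewrite eq_le; apply/andP; split; first exact/nneseries_sum_le.
  have s0 : (0 <= \sum_(0 <= k <oo) (u k)%:E)%E.
    by apply: nneseries_ge0 => k _ _; rewrite lee_fin.
  case: (\sum_(0 <= k <oo) (u k)%:E)%E (@nneseries_sum_le u) s0 => [r| |] H //= _.
    by rewrite lee_fin; apply: h'; apply/H => //.
  by rewrite leey.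
split=> [|B /nneseries_sum_le]; first by apply/nneseries_sum_le => //; rewrite h.
by rewrite h lee_fin; apply.
Qed.

Lemma sums_to_ex u B : (forall i, 0 <= u i) -> sum_le u B ->
  exists V, sums_to u V.
Proof.
move=> u0 /nneseries_sum_le => /(_ u0) h.
have s0 : (0 <= \sum_(0 <= k <oo) (u k)%:E)%E.
  by apply: nneseries_ge0 => k _ _; rewrite lee_fin.
have : (\sum_(0 <= k <oo) (u k)%:E)%E \is a fin_num.
  by rewrite ge0_fin_numE// (le_lt_trans h)// ltry.
move=> /fineK e; exists (fine (\sum_(0 <= k <oo) (u k)%:E)%E).
by apply/sums_toP.
Qed.

Lemma sums_to_head u V n : (forall i, 0 <= u i) -> sums_to u V -> headsum u n <= V.
Proof. by move=> u0 [h _]; exact: (proj1 (sum_leP V u0) h n). Qed.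

Lemma headsum0 u : headsum u 0 = 0.
Proof. exact: big_geq. Qed.

Lemma headsum_mono u m n : (forall i, 0 <= u i) -> (m <= n)%N -> headsum u m <= headsum u n.
Proof.
move=> u0 mn; rewrite /headsum (big_cat_nat (leq0n m) mn) /= lerDl.
by apply: sumr_ge0.
Qed.

Lemma sums_to_tail_small u V e : (forall i, 0 <= u i) -> sums_to u V ->
  0 < e -> exists n, V - headsum u n < e.
Proof.
move=> u0 [h h'] e0; apply: contrapT => H.
have : V <= V - e.
  apply: h'; apply/sum_leP => // n; rewrite leNgt; apply/negP => lt.
  by apply: H; exists n; lra.
by lra.
Qed.

Lemma sum_le_lim0 u B e : (forall i, 0 <= u i) -> sum_le u B -> 0 < e ->
  exists N, forall n, (N <= n)%N -> u n < e.
Proof.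
move=> u0 /(sums_to_ex u0)[V hV] e0.
have [N hN] := sums_to_tail_small u0 hV e0; exists N => n Nn.
have := sums_to_head n.+1 u0 hV; rewrite /headsum big_nat_recr//=.
have := headsum_mono u0 Nn; move: hN; rewrite /headsum; lra.
Qed.

Lemma sum_le_tail u V m s : (forall i, 0 <= u i) -> sums_to u V ->
  uniq s -> (forall i, i \in s -> (m <= i)%N) ->
  \sum_(i <- s) u i <= V - headsum u m.
Proof.
move=> u0 [h _] us sm.
have := h (index_iota 0 m ++ s).
rewrite big_cat/= -/(headsum u m) => H; rewrite lerBrDl; apply: H.
rewrite cat_uniq iota_uniq us andbT /=; apply/hasPn => i /sm mi.
by rewrite mem_index_iota /= -leqNgt.
Qed.

Lemma sum_le_single (a : R) n (u : nat -> R) : 0 <= a -> u n <= a ->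
  (forall i, i != n -> u i = 0) -> sum_le u a.
Proof.
move=> a0 ua un s us; have [ns|ns] := boolP (n \in s).
  rewrite (bigD1_seq n)//= big1 ?addr0// => i /un ->//.
by rewrite big1_seq// => i /= si; apply: un; apply: contraNneq ns => <-.
Qed.

Lemma sums_toD u v U V : (forall i, 0 <= u i) -> (forall i, 0 <= v i) ->
  sums_to u U -> sums_to v V -> sums_to (fun i => u i + v i) (U + V).
Proof.
move=> u0 v0 /(sums_toP _ u0) uU /(sums_toP _ v0) vV.
apply/sums_toP; first by move=> i; rewrite addr_ge0.
rewrite EFinD -uU -vV -nneseriesD//.
- by move=> i _ _; rewrite lee_fin.
- by move=> i _ _; rewrite lee_fin.
Qed.

Lemma sums_to_single a n : 0 <= a -> sums_to (fun i => (i == n)%:R * a : R) a.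
Proof.
move=> a0; split=> [|B /(sum_le_term n)]; last by rewrite eqxx mul1r.
apply: (@sum_le_single a n) => //; first by rewrite eqxx mul1r.
by move=> i /negPf ->; rewrite mul0r.
Qed.

Lemma sums_toZ c u V : 0 <= c -> (forall i, 0 <= u i) -> sums_to u V ->
  sums_to (fun i => c * u i) (c * V).
Proof.
move=> c0 u0 /(sums_toP _ u0) uV; apply/sums_toP; first by move=> i; rewrite mulr_ge0.
rewrite EFinM -uV -nneseriesZl//.
by move=> i _; rewrite lee_fin.
Qed.

Lemma tail_le u v U V m : (forall i, 0 <= u i) -> (forall i, u i <= v i) ->
  sums_to u U -> sums_to v V -> U - headsum u m <= V - headsum v m.
Proof.
move=> u0 uv uU vV; have v0 i : 0 <= v i := le_trans (u0 i) (uv i).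
suff : U <= headsum u m + (V - headsum v m) by lra.
apply: (proj2 uU); apply/sum_leP => // n.
have [nm|/ltnW mn] := leqP n m.
  have := headsum_mono u0 nm; have := sums_to_head m v0 vV; lra.
have := sums_to_head n v0 vV.
rewrite /headsum !(big_cat_nat (leq0n m) mn)/=.
have : \sum_(m <= i < n) u i <= \sum_(m <= i < n) v i by apply: ler_sum.
lra.
Qed.

End Sums.

(** * Nonincreasing enumerations *)

(** The cardinal of [A] is at most [m]; stated with lists so that finiteness of [A] need not be
    established first. *)
Definition few (A : pred nat) (m : nat) : Prop :=
  forall s, uniq s -> all A s -> (size s <= m)%N.

Definition sum_off_le {R : realType} (A : pred nat) (u : nat -> R) (B : R) : Prop :=
  forall s, uniq s -> (forall i, i \in s -> ~~ A i) -> \sum_(i <- s) u i <= B.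

(** The nonincreasing rearrangement as a list of indices: [u \o f] is the rearrangement. Some
    zeros of [u] must be left out when [u] also has infinitely many nonzero terms. *)
Definition decr_enum {R : realType} (u : nat -> R) (f : nat -> nat) : Prop :=
  [/\ injective f, forall m n, (m <= n)%N -> u (f n) <= u (f m) &
      forall i, u i != 0 -> exists n, f n = i].

Section Enum.
Context {R : realType}.
Implicit Types (u y : nat -> R).

Lemma seq_argmax u (j : nat) (s : seq nat) : j \in s ->
  exists2 i, i \in s & forall k, k \in s -> u k <= u i.
Proof.
elim: s j => // a s IH j _; have [->|] := eqVneq s [::].
  by exists a; rewrite ?mem_head// => k; rewrite inE => /eqP ->.
case: s IH => // b s IH _; have [i si im] := IH b (mem_head _ _).
have [ai|/ltW ia] := lerP (u a) (u i).
  exists i; first by rewrite inE si orbT.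
  by move=> k; rewrite inE => /orP[/eqP ->//|/im].
exists a; first exact: mem_head.
by move=> k; rewrite inE => /orP[/eqP ->//|/im ki]; apply: le_trans ki ia.
Qed.

Lemma argmax_off u (A : seq nat) : (forall i, 0 <= u i) ->
  (forall e, 0 < e -> exists N, forall n, (N <= n)%N -> u n < e) ->
  exists2 i, i \notin A & forall j, j \notin A -> u j <= u i.
Proof.
move=> u0 ul.
have [[j jA uj]|H] := pselect (exists2 j, j \notin A & 0 < u j); last first.
  exists (\max_(i <- A) i).+1.
    apply/negP => /(@leq_bigmax_seq _ A xpredT id) /(_ isT).
    by rewrite ltnn.
  move=> j jA; apply: le_trans (u0 _); rewrite leNgt; apply/negP => uj.
  by apply: H; exists j.
have [N hN] := ul _ uj.
pose s := [seq i <- iota 0 N | i \notin A].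
have sE i : (i \in s) = (i \notin A) && (i < N)%N.
  by rewrite mem_filter mem_iota.
have js : j \in s.
  by rewrite sE jA ltnNge; apply/negP => /hN; rewrite ltxx.
have [i is_ im] := seq_argmax u js.
exists i; first by move: is_; rewrite sE => /andP[].
move=> k kA; have [kN|/hN kN] := ltnP k N; first by apply: im; rewrite sE kA.
by apply: le_trans (ltW kN) _; exact: im.
Qed.

(** The indices are chosen greedily, each one where the largest remaining value is attained. If
    a nonzero value were never chosen, all the chosen values would be at least as large, against the
    convergence to zero. *)
Lemma decr_enum_ex u : (forall i, 0 <= u i) ->
  (forall e, 0 < e -> exists N, forall n, (N <= n)%N -> u n < e) ->
  exists f, decr_enum u f.
Proof.
move=> u0 ul.
have /choice[g gP] : forall A : seq nat, exists i, i \notin A /\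
    forall j, j \notin A -> u j <= u i.
  by move=> A; have [i] := argmax_off A u0 ul; exists i.
pose L := fix L n := if n is m.+1 then g (L m) :: L m else [::].
pose f n := g (L n).
have LS m n : (m < n)%N -> f m \in L n.
  elim: n => // n IH; rewrite ltnS leq_eqVlt => /orP[/eqP <-|/IH h].
    by rewrite /= mem_head.
  by rewrite /= inE h orbT.
have Lsub m n : (m <= n)%N -> {subset L m <= L n}.
  move=> /subnK <-; elim: (n - m)%N => //= k IH i /IH h.
  by rewrite inE h orbT.
have fneq m n : (m < n)%N -> f m <> f n.
  by move=> /LS h e; have [] := gP (L n); rewrite -/(f n) -e h.
have finj : injective f.
  by move=> m n e; case: (ltngtP m n) => // /fneq; rewrite e.
have fmono m n : (m <= n)%N -> u (f n) <= u (f m).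
  move=> mn; have [_ ] := gP (L m); apply; apply/negP => /(Lsub _ _ mn).
  by have [/negP] := gP (L n).
exists f; split => // i ui0; apply: contrapT => H.
have iL n : i \notin L n.
  elim: n => //= n IH; rewrite inE negb_or IH andbT.
  by apply/eqP => e; apply: H; exists n.
have ile n : u i <= u (f n) by have [_] := gP (L n); apply.
have ui : 0 < u i by rewrite lt_neqAle eq_sym ui0 u0.
have [N hN] := ul _ ui.
have NP n : (f n < N)%N.
  by rewrite ltnNge; apply/negP => /hN; rewrite ltNge ile.
have : (size (map f (iota 0 N.+1)) <= size (iota 0 N))%N.
  apply: uniq_leq_size; first by rewrite map_inj_uniq ?iota_uniq.
  by move=> k /mapP[l _ ->]; rewrite mem_iota /= NP.
by rewrite size_map !size_iota ltnn.
Qed.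

(** A set of [n] indices misses one of [f 0, ..., f n], so the supremum off it is at least the
    value at [f n]; the set of [f 0, ..., f (n - 1)] attains this. *)
Lemma rearr_enum y f n : decr_enum (fun i => `|y i|) f -> rearr y n = `|y (f n)|.
Proof.
move=> [finj fmono fsupp].
have yle i : `|y i| <= `|y (f 0%N)|.
  have [->//|/fsupp[k <-]] := eqVneq `|y i| 0.
  exact: fmono.
have lb A : (A #= `I_n)%card -> `|y (f n)| <= sup [set `|y i| | i in ~` A].
  move=> cA; have [k kn kA] : exists2 k, (k <= n)%N & ~ A (f k).
    apply: contrapT => H.
    have sub : f @` `I_n.+1 `<=` A.
      move=> _ [k /= kn <-]; apply: contrapT => Ak; apply: H.
      by exists k.
    have := subset_card_le sub.
    rewrite (card_le_eqr cA) (card_le_eql (inj_card_eq _)).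
      by rewrite card_le_II ltnn.
    by move=> ? ? _ _; apply: finj.
  apply: le_trans (fmono _ _ kn) _; apply: ub_le_sup; last by exists (f k).
  by exists `|y (f 0%N)| => _ [i _ <-].
have att : exists2 A, (A #= `I_n)%card & sup [set `|y i| | i in ~` A] = `|y (f n)|.
  exists (f @` `I_n); first by apply: inj_card_eq => ? ? _ _; apply: finj.
  have nA : (~` (f @` `I_n)) (f n).
    by move=> [k /= kn /finj e]; rewrite e ltnn in kn.
  apply/eqP; rewrite eq_le; apply/andP; split.
    apply: ge_sup; first by exists `|y (f n)|, (f n).
    move=> _ [i iA <-]; have [->//|/fsupp[k e]] := eqVneq `|y i| 0.
    rewrite -e; apply: fmono; rewrite leqNgt; apply/negP => kn.
    by apply: iA; exists k.
  apply: ub_le_sup; last by exists (f n).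
  by exists `|y (f 0%N)| => _ [i _ <-].
apply/eqP; rewrite eq_le; apply/andP; split.
  have [A cA <-] := att; apply: ge_inf; last by exists A.
  by exists `|y (f n)| => _ [B cB <-]; exact: lb.
apply: lb_le_inf; last by move=> _ [B cB <-]; exact: lb.
by have [A cA _] := att; exists (sup [set `|y i| | i in ~` A]), A.
Qed.

(** If [N] is selected, it is at least the number of indices selected before it, so the new term
    is at most the next term of the head. *)
Lemma headsum_count u (P : pred nat) N : (forall m n, (m <= n)%N -> u n <= u m) ->
  \sum_(0 <= k < N | P k) u k <= headsum u (count P (iota 0 N)).
Proof.
move=> um; elim: N => [|N IH]; first by rewrite big_geq// /headsum big_geq.
rewrite -[in iota _ _]addn1 iotaD count_cat add0n [count P (iota N 1)]/= addn0.
rewrite big_mkcond big_nat_recr// -big_mkcond /=.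
case: (P N); last by rewrite addn0 addr0.
rewrite addn1 /headsum big_nat_recr//=; apply: lerD => //.
by apply: um; rewrite -{2}(size_iota 0 N); apply: count_size.
Qed.

(** No [m] terms have a larger sum than the first [m] terms of the enumeration. So whatever [m]
    terms are removed, the sum of the others bounds the tail of the enumeration. *)
Lemma decr_enum_tail u f (A : pred nat) m B : (forall i, 0 <= u i) ->
  decr_enum u f -> few A m -> sum_off_le A u B ->
  sum_le u (headsum (u \o f) m + B).
Proof.
move=> u0 [fi fm fs] sA sB; apply: sum_le_supp fs _; apply/sum_leP => [i|n] /=.
  exact: u0.
rewrite /headsum (bigID (fun k => A (f k))) /=; apply: lerD.
  apply: le_trans (headsum_count (u := u \o f) _ n fm) _.
  apply: headsum_mono => [i|]; first exact: u0.
  rewrite -size_filter -(size_map f); apply: sA.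
    by rewrite map_inj_uniq// filter_uniq// iota_uniq.
  by apply/allP => _ /mapP[k + ->]; rewrite mem_filter => /andP[].
rewrite -big_filter -(big_map f xpredT u); apply: sB.
  by rewrite map_inj_uniq// filter_uniq// iota_uniq.
by move=> _ /mapP[k + ->]; rewrite mem_filter => /andP[].
Qed.

End Enum.

(** * The spaces l^r *)

Definition pw {R : realType} (r : R) (x : nat -> R) (i : nat) : R := `|x i| `^ r.

Section Ell.
Context {R : realType}.
Implicit Types (w x y : nat -> R) (q r t B V : R).

Lemma pw_ge0 r x i : 0 <= pw r x i.
Proof. exact: powR_ge0. Qed.

Lemma pw_le r x y i : 0 < r -> `|x i| <= `|y i| -> pw r x i <= pw r y i.
Proof.
by move=> /ltW r0 h; apply: ge0_ler_powR; rewrite ?nnegrE.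
Qed.

Lemma powR_leE r (a b : R) : 0 < r -> 0 <= a -> 0 <= b -> (a `^ r <= b `^ r) = (a <= b).
Proof.
move=> r0 a0 b0; apply/idP/idP => [|h]; last first.
  by apply: ge0_ler_powR; rewrite ?nnegrE// ltW.
by apply: contraTT; rewrite -!ltNge => h; rewrite gt0_ltr_powR.
Qed.

Lemma powR_eq0r r (a : R) : 0 < r -> (a `^ r == 0) = (a == 0).
Proof. by move=> r0; rewrite powR_eq0 (gt_eqF r0) andbT. Qed.

Lemma powRK r (a : R) : 0 < r -> 0 <= a -> (a `^ r) `^ r^-1 = a.
Proof. by move=> r0 a0; rewrite -powRrM divff ?gt_eqF// powRr1. Qed.

Lemma powRVK r (a : R) : 0 < r -> 0 <= a -> (a `^ r^-1) `^ r = a.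
Proof. by move=> r0 a0; rewrite -powRrM mulVf ?gt_eqF// powRr1. Qed.

Lemma powR_normD r (a b : R) : 0 < r ->
  `|a + b| `^ r <= 2 `^ r * (`|a| `^ r + `|b| `^ r).
Proof.
move=> r0.
wlog ab : a b / `|a| <= `|b|.
  move=> W; have [/W //|/ltW/W] := lerP `|a| `|b|.
  by rewrite addrC [X in _ * X]addrC.
have : `|a + b| <= 2 * `|b| by have := ler_normD a b; lra.
rewrite -(powR_leE r0)// ?mulr_ge0// powRM// => /le_trans; apply.
by rewrite ler_wpM2l ?powR_ge0// lerDr powR_ge0.
Qed.

Lemma sum_le_pwD r x y B B' : 0 < r -> sum_le (pw r x) B -> sum_le (pw r y) B' ->
  sum_le (pw r (x + y)) (2 `^ r * (B + B')).
Proof.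
move=> r0 hx hy; apply: sum_le_mono (sum_leZ (powR_ge0 2 r) (sum_leD hx hy)) => i.
exact: powR_normD.
Qed.

Lemma pwZ r a x i : pw r (a *: x) i = `|a| `^ r * pw r x i.
Proof. by rewrite /pw /GRing.scale/= normrM powRM. Qed.

Lemma sums_to_pwZ q t w V : 0 <= t -> sums_to (pw q w) V ->
  sums_to (pw q (t *: w)) (t `^ q * V).
Proof.
move=> t0 wV; have -> : pw q (t *: w) = (fun i => t `^ q * pw q w i).
  by apply/funext => i; rewrite pwZ ger0_norm.
by apply: sums_toZ => //; [exact: powR_ge0 | exact: pw_ge0].
Qed.

Lemma ell_sum r x : 0 < r -> carrier (ell r) x ->
  sums_to (pw r x) (qnorm (ell r) x `^ r).
Proof.
move=> r0 /= h; have s0 : (0 <= \sum_(0 <= k <oo) (pw r x k)%:E)%E.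
  by apply: nneseries_ge0 => k _ _; rewrite lee_fin pw_ge0.
have fs : (\sum_(0 <= k <oo) (pw r x k)%:E)%E \is a fin_num.
  rewrite ge0_fin_numE//; apply: lty_poweRy h.
  by rewrite invr_eq0 gt_eqF.
apply/sums_toP; first by move=> i; exact: pw_ge0.
rewrite /ell_norm fine_poweR powRVK//; last exact: fine_ge0.
by rewrite fineK.
Qed.

Lemma pw_series_eq q x y V : sums_to (pw q x) V -> sums_to (pw q y) V ->
  (\sum_(0 <= n <oo) (`|x n| `^ q)%:E = \sum_(0 <= n <oo) (`|y n| `^ q)%:E)%E.
Proof.
by move=> /(sums_toP _ (pw_ge0 q x)) -> /(sums_toP _ (pw_ge0 q y)) ->.
Qed.

Lemma qnorm_ell_ge0 r x : 0 <= qnorm (ell r) x.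
Proof. exact: fine_ge0 (poweR_ge0 _ _). Qed.

Lemma ell_intro r x B : 0 < r -> sum_le (pw r x) B ->
  carrier (ell r) x /\ qnorm (ell r) x <= B `^ r^-1.
Proof.
move=> r0 h; have [V hV] := sums_to_ex (pw_ge0 r x) h.
have V0 : 0 <= V by apply: sum_le_ge0 (proj1 hV).
have VB : V <= B by apply: (proj2 hV).
have /(sums_toP _ (pw_ge0 r x)) e := hV.
split=> /=; first by rewrite /ell_norm e poweR_EFin ltry.
rewrite /ell_norm e poweR_EFin /= powR_leE// ?invr_gt0//.
exact: le_trans VB.
Qed.

Lemma ellP r x : 0 < r -> carrier (ell r) x <-> exists B, sum_le (pw r x) B.
Proof.
move=> r0; split=> [/(ell_sum r0)[h _]|[B /(ell_intro r0)[]]//].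
by exists (qnorm (ell r) x `^ r).
Qed.

Lemma bounded_on_ellP r (T : (nat -> R) -> (nat -> R)) : 0 < r ->
  bounded_on (ell r) T <-> exists2 M, 0 <= M &
    forall x B, sum_le (pw r x) B -> sum_le (pw r (T x)) (M * B).
Proof.
move=> r0; split=> [[M hM]|[M M0 hM]].
  exists (Num.max M 0 `^ r); first exact: powR_ge0.
  move=> x B hB; have [xr _] := ell_intro r0 hB.
  have [Tr TM] := hM _ xr.
  apply: sum_le_trans (proj1 (ell_sum r0 Tr)) _.
  have n0 := qnorm_ell_ge0 r.
  apply: (@le_trans _ _ ((Num.max M 0 * qnorm (ell r) x) `^ r)).
    rewrite powR_leE// ?mulr_ge0// ?le_max ?lexx ?orbT//.
    by apply: le_trans TM _; rewrite ler_wpM2r// le_max lexx.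
  rewrite powRM// ?le_max ?lexx ?orbT// ler_wpM2l ?powR_ge0//.
  exact: (proj2 (ell_sum r0 xr)).
exists (M `^ r^-1) => x xr.
have [] := ell_intro r0 (hM _ _ (proj1 (ell_sum r0 xr))).
by rewrite powRM ?powR_ge0// powRK// qnorm_ell_ge0.
Qed.

End Ell.

(** * Collecting mass from blocks of indices *)

Section Block.
Context {R : realType}.
Implicit Types (f g x y z : nat -> R) (q r V : R).

(** The tails [F] of [f] are cut at the heights [H n], the means of the tails of [f] and [g].
    Between two consecutive heights lies half of [f n + g n]. The tail at the start of the block
    for [n] may fall short of [H n], but by less than one term: as [H n <= F n], that term has
    index at least [n], so it is at most [f n] because [f] is nonincreasing. With the heights [G
    n] alone, a tail of [g] that vanishes might never be reached by [F]. *)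
Lemma tail_blocks f g V : (forall i, 0 <= f i) -> (forall i, 0 <= g i) ->
  (forall m n, (m <= n)%N -> f n <= f m) ->
  sums_to f V -> sums_to g V -> (forall m, headsum f m <= headsum g m) ->
  exists2 c : nat -> nat, (forall n, (c n <= c n.+1)%N) &
    forall n, 2 * f n < g n -> g n <= 4 * \sum_(c n <= k < c n.+1) f k.
Proof.
move=> f0 g0 fm fV gV fg.
pose F k := V - headsum f k; pose G k := V - headsum g k.
pose H n := (F n + G n) / 2.
have F0 k : 0 <= F k by rewrite subr_ge0 (sums_to_head k f0 fV).
have G0 k : 0 <= G k by rewrite subr_ge0 (sums_to_head k g0 gV).
have GF k : G k <= F k by rewrite lerD2l lerN2.
have FS k : F k.+1 = F k - f k by rewrite /F /headsum big_nat_recr//=; lra.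
have GS k : G k.+1 = G k - g k by rewrite /G /headsum big_nat_recr//=; lra.
have Fm m n : (m <= n)%N -> F n <= F m.
  by move=> mn; rewrite lerD2l lerN2 headsum_mono.
have ex n : exists k, F k <= H n.
  have [h|h] := lerP (H n) 0.
    by exists n; rewrite /H; have := F0 n; have := G0 n; move: h; rewrite /H; lra.
  by have [k /ltW] := sums_to_tail_small f0 fV h; exists k.
pose c n := ex_minn (ex n).
exists c => [n|n fgn].
  rewrite /c; case: (ex_minnP (ex n)) => k _; apply.
  case: ex_minnP => l /le_trans + _; apply.
  by rewrite /H FS GS; have := f0 n; have := g0 n; lra.
have cn : H n - f n <= F (c n).
  rewrite /c; case: ex_minnP => -[|k] hk hmin.
    by have := Fm _ _ (leq0n n); have := f0 n; have := GF n; rewrite /H; lra.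
  have [kn|nk] := leqP k.+1 n.
    by have := Fm _ _ kn; have := f0 n; have := GF n; rewrite /H; lra.
  have : H n < F k by rewrite ltNge; apply/negP => /hmin; rewrite ltnn.
  by rewrite FS; have := fm n k nk; lra.
have cn1 : F (c n.+1) <= H n.+1 by rewrite /c; case: ex_minnP.
have cc : (c n <= c n.+1)%N.
  rewrite /c; case: (ex_minnP (ex n)) => k _; apply.
  case: ex_minnP => l /le_trans + _; apply.
  by rewrite /H FS GS; have := f0 n; have := g0 n; lra.
have -> : \sum_(c n <= k < c n.+1) f k = F (c n) - F (c n.+1).
  by rewrite /F /headsum (big_cat_nat (leq0n _) cc)/=; lra.
by move: cn1 cn; rewrite /H FS GS; lra.
Qed.

(** Young's inequality without its weights, proved by comparing [a] and [b]; it costs a factor two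
    in Hoelder's inequality below. *)
Lemma young_weak q (a b : R) : 1 <= q -> 0 <= a -> 0 <= b ->
  a `^ (q - 1) * b <= a `^ q + b `^ q.
Proof.
move=> q1 a0 b0.
have q0 : 0 < q by lra.
have [ba|/ltW ab] := lerP b a.
  rewrite -(mulr_powRB1 a0 q0) mulrC.
  apply: (@le_trans _ _ (a * a `^ (q - 1))); first by rewrite ler_wpM2r ?powR_ge0.
  by rewrite lerDl powR_ge0.
rewrite -(mulr_powRB1 b0 q0).
apply: (@le_trans _ _ (b * b `^ (q - 1))).
  rewrite mulrC ler_wpM2l//; apply: ge0_ler_powR; rewrite ?nnegrE//; lra.
by rewrite lerDr powR_ge0.
Qed.

(** The norms are given by upper bounds [A] and [B], so that normalising needs no case
    distinction for vanishing sums. *)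
Lemma hoelder_weak q (I : Type) (s : seq I) (a b : I -> R) (A B : R) : 1 <= q ->
  0 < A -> 0 < B -> (forall i, 0 <= a i) -> (forall i, 0 <= b i) ->
  \sum_(i <- s) a i `^ q <= A `^ q -> \sum_(i <- s) b i `^ q <= B `^ q ->
  \sum_(i <- s) a i `^ (q - 1) * b i <= 2 * (A `^ (q - 1) * B).
Proof.
move=> q1 A0 B0 a0 b0 hA hB.
have pA : 0 < A `^ q by exact: powR_gt0.
have pB : 0 < B `^ q by exact: powR_gt0.
have D (c C : R) : 0 <= c -> 0 < C -> (c / C) `^ q = c `^ q / C `^ q.
  move=> c0 C0; rewrite powRM ?invr_ge0// ?ltW//.
  by rewrite -(powR_inv1 (ltW C0)) -powRrM mulN1r powRN.
apply: (@le_trans _ _ (\sum_(i <- s) A `^ (q - 1) * B *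
    (a i `^ q / A `^ q + b i `^ q / B `^ q))).
  apply: ler_sum => i _.
  have := young_weak q1 (divr_ge0 (a0 i) (ltW A0)) (divr_ge0 (b0 i) (ltW B0)).
  rewrite !D//.
  have -> : a i `^ (q - 1) * b i =
      A `^ (q - 1) * B * ((a i / A) `^ (q - 1) * (b i / B)).
    have -> : a i `^ (q - 1) = A `^ (q - 1) * (a i / A) `^ (q - 1).
      rewrite -powRM ?divr_ge0// ?ltW//; congr (_ `^ _).
      by field; rewrite gt_eqF.
    by field; rewrite gt_eqF.
  by move=> h; rewrite ler_wpM2l// mulr_ge0 ?powR_ge0// ltW.
rewrite -mulr_sumr big_split -!mulr_suml/= mulrC ler_wpM2r//.
  by rewrite mulr_ge0 ?powR_ge0// ltW.
have : (\sum_(i <- s) a i `^ q) / A `^ q <= 1 by rewrite ler_pdivrMr// mul1r.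
have : (\sum_(i <- s) b i `^ q) / B `^ q <= 1 by rewrite ler_pdivrMr// mul1r.
lra.
Qed.

Lemma powR_split p q (c : R) : 0 < p -> p <= q -> c `^ q = c `^ (q - p) * c `^ p.
Proof.
move=> p0 pq; have q0 : 0 < q by lra.
have [->|c0] := eqVneq c 0.
  by rewrite (powR0 (lt0r_neq0 q0)) (powR0 (lt0r_neq0 p0)) mulr0.
by rewrite -powRD ?c0 ?implybT// subrK.
Qed.

Lemma sum_powR_le q r (I : Type) (s : seq I) (b : I -> R) (B : R) : 0 < r -> r <= q ->
  0 <= B -> (forall i, 0 <= b i <= B) -> \sum_(i <- s) b i `^ r <= B `^ r ->
  \sum_(i <- s) b i `^ q <= B `^ q.
Proof.
move=> r0 rq B0 bB h.
have E (c : R) := powR_split c r0 rq.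
rewrite E; apply: le_trans (ler_wpM2l (powR_ge0 _ _) h).
rewrite mulr_sumr; apply: ler_sum => i _; rewrite E ler_wpM2r ?powR_ge0//.
by have /andP[b0 bB'] := bB i; apply: ge0_ler_powR; rewrite ?nnegrE// subr_ge0.
Qed.

(** The functional is the one for which Hoelder's inequality is sharp at [X], scaled to take the
    value [Y] there. Its norm on [l^q] is at most [8], and the [q]-norm over the block is at most
    the [r]-norm. *)
Lemma block_functional_le q r (s : seq nat) (X z : nat -> R) (Y S : R) :
  1 <= q -> 0 < r -> r <= q -> (forall i, 0 <= X i) -> 0 <= Y ->
  S = \sum_(k <- s) X k `^ q -> 0 < S -> Y `^ q <= 4 * S ->
  `|Y / S * \sum_(k <- s) X k `^ (q - 1) * z k| `^ r <=
  8 `^ r * \sum_(k <- s) `|z k| `^ r.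
Proof.
move=> q1 r0 rq X0 Y0 SE S0 YS.
have q0 : 0 < q by lra.
set Z := \sum_(k <- s) `|z k| `^ r.
have Zk k : k \in s -> `|z k| `^ r <= Z.
  move=> ks; rewrite /Z (big_rem k)//= lerDl.
  by apply: sumr_ge0 => i _; exact: powR_ge0.
have Z0 : 0 <= Z by apply: sumr_ge0 => i _; exact: powR_ge0.
have [Ze|Zn0] := eqVneq Z 0.
  rewrite big1_seq ?mulr0 ?normr0 ?powR0 ?gt_eqF//; last first.
    move=> k /= /Zk; rewrite Ze => h.
    have : `|z k| `^ r == 0 by rewrite eq_le h powR_ge0.
    by rewrite powR_eq0r// normr_eq0 => /eqP ->; rewrite mulr0.
  by rewrite mulr_ge0// powR_ge0.
have Zp : 0 < Z by rewrite lt_neqAle eq_sym Zn0.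
pose B := Z `^ r^-1; have B0 : 0 < B by exact: powR_gt0.
pose A := S `^ q^-1; have A0 : 0 < A by exact: powR_gt0.
have Bq : \sum_(k <- s) `|z k| `^ q <= B `^ q.
  (* the bound by [B] is available on the block only, so cut [z] off outside it *)
  pose b k := if k \in s then `|z k| else 0.
  rewrite (eq_big_seq (fun k => b k `^ q)); last by move=> k ks; rewrite /b ks.
  apply: (sum_powR_le r0 rq (ltW B0)).
    move=> k; rewrite /b; case: ifPn => [ks|_]; last by rewrite lexx ltW.
    by rewrite normr_ge0 -(powR_leE r0) ?(ltW B0)// powRVK// Zk.
  rewrite (eq_big_seq (fun k => `|z k| `^ r)); last by move=> k ks; rewrite /b ks.
  by rewrite powRVK.
have Aq : \sum_(k <- s) X k `^ q <= A `^ q by rewrite -SE powRVK ?(ltW S0).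
have H := hoelder_weak q1 A0 B0 X0 (fun k => normr_ge0 (z k)) Aq Bq.
have YA : Y <= 4 * A.
  rewrite -(powR_leE q0) ?mulr_ge0 ?(ltW A0)//; apply: le_trans YS _.
  rewrite powRM ?(ltW A0)// powRVK ?(ltW S0)// ler_wpM2r ?(ltW S0)//.
  by rewrite le1r_powR// ler1n.
have K : `|Y / S * \sum_(k <- s) X k `^ (q - 1) * z k| <= 8 * B.
  rewrite normrM ger0_norm ?divr_ge0 ?(ltW S0)//.
  apply: (@le_trans _ _ (4 * A / S * (2 * (A `^ (q - 1) * B)))).
    apply: ler_pM; rewrite ?divr_ge0 ?(ltW S0)//.
      by rewrite ler_wpM2r// invr_ge0 ltW.
    apply: le_trans H; apply: le_trans (ler_norm_sum _ _ _) _.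
    by apply: ler_sum => k _; rewrite normrM ger0_norm ?powR_ge0.
  have -> : 4 * A / S * (2 * (A `^ (q - 1) * B)) = 8 * (A * A `^ (q - 1)) / S * B.
    by field; rewrite gt_eqF.
  by rewrite mulr_powRB1 ?(ltW A0)// powRVK ?(ltW S0)// mulfK ?gt_eqF.
apply: le_trans (_ : (8 * B) `^ r <= _); first by rewrite powR_leE ?mulr_ge0 ?(ltW B0).
by rewrite powRM ?(ltW B0)// powRVK.
Qed.

End Block.

Section Operator.
Context {R : realType}.
Implicit Types (u v x y z : nat -> R) (q r V B : R).

Lemma decr_enum_pw q y f : 0 < q ->
  decr_enum (pw q y) f -> decr_enum (fun i => `|y i|) f.
Proof.
move=> q0 [fi fm fs]; split => // [m n /fm|i yi]; first by rewrite powR_leE.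
by apply: fs; rewrite powR_eq0r.
Qed.

Lemma pw_enum_ex q y B : 0 < q -> sum_le (pw q y) B ->
  exists f, decr_enum (pw q y) f.
Proof.
move=> q0 h; apply: decr_enum_ex; first exact: pw_ge0.
by move=> e; apply: sum_le_lim0 h; exact: pw_ge0.
Qed.

Lemma rearr_heads q y f m : 0 < q -> decr_enum (pw q y) f ->
  \sum_(0 <= n < m) rearr y n `^ q = headsum (pw q y \o f) m.
Proof.
move=> q0 yf; apply: eq_bigr => n _.
by rewrite (rearr_enum _ (decr_enum_pw q0 yf)).
Qed.

Lemma sum_blocks (c : nat -> nat) u N : (forall n, (c n <= c n.+1)%N) ->
  \sum_(0 <= n < N) \sum_(c n <= k < c n.+1) u k = \sum_(c 0%N <= k < c N) u k.
Proof.
move=> cS; elim: N => [|N IH]; first by rewrite !big_geq.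
rewrite big_nat_recr//= IH -big_cat_nat//.
by elim: N {IH} => // N /leq_trans; apply.
Qed.

Definition block_const r : R := 2 `^ r * (2 `^ r + 8 `^ r).

(** Entries of [y] at most [2^(1/q)] times those of [x] at the same rank are reached by doubling,
    the others by the functionals of the blocks given by [tail_blocks]. Disjointness of the blocks
    turns the bounds for the single functionals into a bound on [l^r]. *)
Lemma block_operator q x y V : 1 <= q ->
  sums_to (pw q x) V -> sums_to (pw q y) V ->
  (forall m, \sum_(0 <= n < m) rearr x n `^ q <= \sum_(0 <= n < m) rearr y n `^ q) ->
  exists T : (nat -> R) -> (nat -> R), [/\
    forall a u v, T (a *: u + v) = a *: T u + T v,
    forall u, (forall i, 0 <= u i) -> forall i, 0 <= T u i,
    forall i, `|y i| <= T (fun k => `|x k|) i &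
    forall r z B, 0 < r -> r <= q -> sum_le (pw r z) B ->
      sum_le (pw r (T z)) (block_const r * B)].
Proof.
move=> q1 xV yV hxy; have q0 : 0 < q by lra.
have [t tE] := pw_enum_ex q0 (proj1 xV).
have [s sE] := pw_enum_ex q0 (proj1 yV).
have [ti tm ts] := tE; have [si sm ss] := sE.
have tV := sums_to_reindex ti ts xV.
have sV := sums_to_reindex si ss yV.
pose f := pw q x \o t; pose g := pw q y \o s.
have f0 i : 0 <= f i by exact: pw_ge0.
have g0 i : 0 <= g i by exact: pw_ge0.
have fg m : headsum f m <= headsum g m.
  by have := hxy m; rewrite [leLHS](rearr_heads m q0 tE) [leRHS](rearr_heads m q0 sE).
have [c cS cB] := tail_blocks f0 g0 tm tV sV fg.
pose S n := \sum_(c n <= k < c n.+1) f k.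
pose X k := `|x (t k)|.
(* the doubling term is kept in every row: it only helps the lower bound *)
pose w n := if 2 * f n < g n then `|y (s n)| / S n else 0.
have S0 n : 0 <= S n by apply: sumr_ge0.
have w0 n : 0 <= w n by rewrite /w; case: ifP => // _; rewrite divr_ge0.
pose row z n := 2 * z (t n) +
  w n * \sum_(c n <= k < c n.+1) X k `^ (q - 1) * z (t k).
have /choice[h hP] : forall i, exists n, (exists m, s m = i) -> s n = i.
  move=> i; have [[m <-]|H] := pselect (exists m, s m = i); first by exists m.
  by exists 0%N => /H.
pose d i : R := (`[< exists m, s m = i >])%:R.
pose T z i := d i * row z (h i).
have TE z n : T z (s n) = row z n.
  have e : s (h (s n)) = s n by apply: hP; exists n.
  rewrite /T (si _ _ e) /d; case: asboolP => [_|[]]; first by rewrite mul1r.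
  by exists n.
exists T; split.
- move=> a u v; apply/funext => i.
  have E (u' v' : nat -> R) k : (a *: u' + v') k = a * u' k + v' k by [].
  rewrite E /T /row E.
  have -> : \sum_(c (h i) <= k < c (h i).+1) X k `^ (q - 1) * (a *: u + v) (t k) =
      a * (\sum_(c (h i) <= k < c (h i).+1) X k `^ (q - 1) * u (t k)) +
      \sum_(c (h i) <= k < c (h i).+1) X k `^ (q - 1) * v (t k).
    by rewrite mulr_sumr -big_split; apply: eq_bigr => k _ /=; rewrite E; ring.
  by ring.
- move=> u u0 i; apply: mulr_ge0 => //.
  apply: addr_ge0; first by rewrite mulr_ge0.
  by apply: mulr_ge0 => //; apply: sumr_ge0 => k _; rewrite mulr_ge0 ?powR_ge0.
- move=> i; have [->|yi0] := eqVneq (y i) 0.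
    rewrite normr0 mulr_ge0// addr_ge0 ?mulr_ge0//.
    by apply: sumr_ge0 => k _; rewrite mulr_ge0 ?powR_ge0.
  have [n <-] : exists n, s n = i by apply: ss; rewrite powR_eq0r// normr_eq0.
  rewrite TE /row /w; case: ltP => fgn; last first.
    rewrite mul0r addr0 -(powR_leE q0)// ?mulr_ge0// powRM//.
    apply: le_trans fgn _; rewrite ler_wpM2r ?powR_ge0//.
    by rewrite le1r_powR// ler1n.
  have -> : \sum_(c n <= k < c n.+1) X k `^ (q - 1) * `|x (t k)| = S n.
    by apply: eq_bigr => k _; rewrite mulrC mulr_powRB1.
  rewrite divfK ?lerDr ?mulr_ge0//.
  by have := cB _ fgn; rewrite -/(S n); have := f0 n; lra.
- move=> r z B r0 rq hz; apply: (sum_le_supp (f := s)).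
    move=> i; rewrite powR_eq0r// normr_eq0 /T mulf_eq0 negb_or => /andP[+ _].
    by rewrite /d; case: asboolP => //; rewrite eqxx.
  apply/sum_leP => [i|N]; first exact: pw_ge0.
  pose Z := pw r z \o t.
  have ZB : sum_le Z B by apply: sum_le_inj hz.
  apply: (@le_trans _ _ (\sum_(0 <= n < N) 2 `^ r *
      (2 `^ r * Z n + 8 `^ r * \sum_(c n <= k < c n.+1) Z k))).
    apply: ler_sum => n _; rewrite /= /pw TE /row.
    apply: le_trans (powR_normD _ _ r0) _.
    rewrite ler_wpM2l ?powR_ge0//; apply: lerD.
      by rewrite normrM powRM// ger0_norm.
    rewrite /w; case: ifPn => fgn; last first.
      by rewrite mul0r normr0 powR0 ?gt_eqF// mulr_ge0 ?powR_ge0// sumr_ge0// => k _; exact: pw_ge0.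
    have gS : g n <= 4 * S n := cB _ fgn.
    have Sp : 0 < S n.
      by move: gS fgn (f0 n); move: (S n) (f n) (g n) => a b e *; lra.
    apply: (@block_functional_le _ q r _ X (z \o t) _ (S n)) => //.
    by move=> k; exact: normr_ge0.
  rewrite -mulr_sumr big_split/= -!mulr_sumr sum_blocks//.
  rewrite /block_const -mulrA ler_wpM2l ?powR_ge0// mulrDl.
  apply: lerD; rewrite ler_wpM2l ?powR_ge0//; apply: ZB; exact: iota_uniq.
Qed.

End Operator.

(** * Sums of positive operators *)

Section SumOperator.
Context {R : realType}.
Implicit Types (u v x y z : nat -> R) (q r V B : R).

Lemma geometric_head (c : R) N : 0 <= c < 1 ->
  \sum_(0 <= j < N) c ^+ j.+1 <= c / (1 - c).
Proof.
move=> /andP[c0 c1]; have d0 : 0 < 1 - c by lra.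
rewrite ler_pdivlMr//.
have -> : (\sum_(0 <= j < N) c ^+ j.+1) * (1 - c) = c - c ^+ N.+1.
  elim: N => [|N IH]; first by rewrite big_geq// mul0r expr1 subrr.
  by rewrite big_nat_recr//= mulrDl IH !exprS; ring.
by rewrite gerBl exprn_ge0.
Qed.

Lemma half_geometric_head N : \sum_(0 <= j < N) 2^-1 ^+ j.+1 <= 1 :> R.
Proof.
have half : 1 - 2^-1 = 2^-1 :> R by field.
apply: le_trans (geometric_head N (_ : 0 <= 2^-1 < 1)) _.
  by apply/andP; split; lra.
by rewrite half divff// gt_eqF// invr_gt0.
Qed.

(** Write [4^-j] as [2^-j * 2^-j]: one factor pays for the sum, the other stays on the right to make
    the bound summable. The same estimate serves the convex and the concave powers. *)
Lemma weighted_sum_powR r (t : nat -> R) N : 0 < r ->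
  `|\sum_(0 <= j < N) 4^-1 ^+ j.+1 * t j| `^ r <=
  \sum_(0 <= j < N) (2^-1 ^+ j.+1) `^ r * `|t j| `^ r.
Proof.
move=> r0; set W := leRHS.
have t0 j : 0 <= (2^-1 ^+ j.+1) `^ r * `|t j| `^ r.
  by rewrite mulr_ge0 ?powR_ge0.
have W0 : 0 <= W by apply: sumr_ge0 => j _.
have h0 j : 0 <= 2^-1 ^+ j.+1 :> R by rewrite exprn_ge0// invr_ge0.
have tW j : (j < N)%N -> 2^-1 ^+ j.+1 * `|t j| <= W `^ r^-1.
  move=> jN; rewrite -(powR_leE r0) ?mulr_ge0 ?powR_ge0//.
  rewrite powRVK// powRM// /W (bigD1_seq j) ?mem_index_iota ?iota_uniq//=.
  by rewrite lerDl sumr_ge0.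
suff : `|\sum_(0 <= j < N) 4^-1 ^+ j.+1 * t j| <= W `^ r^-1.
  by rewrite -(powR_leE r0) ?powR_ge0// powRVK.
apply: le_trans (ler_norm_sum _ _ _) _.
apply: (@le_trans _ _ (\sum_(0 <= j < N) 2^-1 ^+ j.+1 * W `^ r^-1)).
  apply: ler_sum_nat => j /andP[_ jN].
  have -> : 4^-1 = 2^-1 * 2^-1 :> R by field.
  by rewrite exprMn !normrM ger0_norm// -mulrA ler_wpM2l// tW.
by rewrite -mulr_suml -[leRHS]mul1r ler_wpM2r ?powR_ge0// half_geometric_head.
Qed.

Lemma sum_le_pw_incl r q z B : 0 < r -> r <= q -> sum_le (pw r z) B ->
  sum_le (pw q z) ((B `^ r^-1) `^ q).
Proof.
move=> r0 rq h s us; have B0 := sum_le_ge0 h.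
apply: (sum_powR_le r0 rq (powR_ge0 _ _)).
  move=> i; rewrite normr_ge0/= -(powR_leE r0) ?powR_ge0// powRVK//.
  exact: (sum_le_term i h).
by rewrite powRVK//; exact: h.
Qed.

(** Fatou's lemma up to a constant: on a finite set of indices, [|v i| <= 2 |w N i|] for large [N],
    which spares the continuity of powers. *)
Lemma sum_le_pw_lim r (w : nat -> nat -> R) v B : 0 < r ->
  (forall N, sum_le (pw r (w N)) B) ->
  (forall i, w N i @[N --> \oo] --> v i) ->
  sum_le (pw r v) (2 `^ r * B).
Proof.
move=> r0 hw hv s us.
have [N hN] : exists N, forall M, (N <= M)%N -> forall i, i \in s -> `|v i| <= 2 * `|w M i|.
  elim: s {us} => [|i s [N1 IH]]; first by exists 0%N.
  have [N2 hN2] : exists N, forall M, (N <= M)%N -> `|v i| <= 2 * `|w M i|.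
    have [->|vi] := eqVneq (v i) 0; first by exists 0%N => M _; rewrite normr0 mulr_ge0.
    have e0 : 0 < `|v i| / 2 by rewrite divr_gt0 ?normr_gt0.
    have /cvgrPdist_lt/(_ _ e0)[N _ hN] := hv i; exists N => M NM.
    have := hN M NM; rewrite /= => h.
    have := ler_normD (v i - w M i) (w M i); rewrite subrK; lra.
  exists (maxn N1 N2) => M; rewrite geq_max => /andP[M1 M2] k.
  by rewrite inE => /orP[/eqP ->|/IH]; [exact: hN2 | apply].
apply: le_trans (ler_wpM2l (powR_ge0 2 r) (hw N s us)).
rewrite mulr_sumr !big_seq; apply: ler_sum => i si.
by rewrite /pw -powRM// powR_leE ?mulr_ge0// hN.
Qed.

(** On nonnegative sequences [S] dominates each of its terms; this is how one operator keeps the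
    information of infinitely many. *)
Lemma sum_operator q (K : R -> R) (T : nat -> (nat -> R) -> (nat -> R)) : 1 <= q ->
  (forall j a u v, T j (a *: u + v) = a *: T j u + T j v) ->
  (forall j u, (forall i, 0 <= u i) -> forall i, 0 <= T j u i) ->
  (forall j r z B, 0 < r -> r <= q -> sum_le (pw r z) B ->
    sum_le (pw r (T j z)) (K r * B)) ->
  exists S : (nat -> R) -> (nat -> R), [/\
    linear_on (ell q) S,
    forall r, 0 < r -> r <= q -> bounded_on (ell r) S &
    forall u, carrier (ell q) u -> (forall i, 0 <= u i) ->
      forall j i, 4^-1 ^+ j.+1 * T j u i <= S u i].
Proof.
move=> q1 Tlin Tpos Tbd; have q0 : 0 < q by lra.
pose P N z i : R := \sum_(0 <= j < N) 4^-1 ^+ j.+1 * T j z i.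
pose S z i := limn (fun N => P N z i).
have cS z i : carrier (ell q) z -> P N z i @[N --> \oo] --> S z i.
  move=> /(ellP _ q0)[B zB].
  pose D := (K q * B) `^ q^-1.
  have TD j : `|T j z i| <= D.
    have h := sum_le_term i (Tbd j q z B q0 (lexx q) zB).
    rewrite -(powR_leE q0) ?powR_ge0// powRVK//.
    exact: le_trans (powR_ge0 _ _) h.
  suff : cvgn (series (fun j => 4^-1 ^+ j.+1 * T j z i)) by [].
  apply: normed_cvg; apply: (@series_le_cvg _ _ (geometric (D / 4) 4^-1)).
  - by move=> n; exact: normr_ge0.
  - move=> n; rewrite /geometric/= mulr_ge0// ?exprn_ge0//.
    by rewrite divr_ge0 ?powR_ge0.
  - move=> n; rewrite /geometric/= normrM ger0_norm ?exprn_ge0//.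
    rewrite exprS; have := TD n => h.
    have p0 : 0 <= 4^-1 ^+ n :> R by rewrite exprn_ge0.
    have -> : D / 4 * 4^-1 ^+ n = 4^-1 * 4^-1 ^+ n * D by ring.
    by rewrite ler_wpM2l// mulr_ge0.
  apply: is_cvg_geometric_series; rewrite ger0_norm; lra.
exists S; split.
- move=> a x y xq yq; apply/funext => i.
  have E (u v : nat -> R) k : (a *: u + v) k = a * u k + v k by [].
  rewrite E; apply: cvg_lim => //.
  have -> : (fun N => P N (a *: x + y) i) = (fun N => a * P N x i + P N y i).
    apply/funext => N; rewrite /P mulr_sumr -big_split; apply: eq_bigr => j _ /=.
    by rewrite Tlin E; ring.
  by apply: cvgD; [apply: cvgMr; exact: cS | exact: cS].
- move=> r r0 rq; apply/bounded_on_ellP => //.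
  pose c : R := 2^-1 `^ r.
  have c01 : 0 <= c < 1.
    have e1 : 1 `^ r = 1 :> R by rewrite powR1.
    rewrite powR_ge0/= /c -[ltRHS]e1.
    by apply: gt0_ltr_powR; rewrite ?nnegrE// ?invr_ge0//; lra.
  pose G := c / (1 - c).
  have G0 : 0 <= G by case/andP: c01 => ? ?; rewrite divr_ge0// subr_ge0 ltW.
  exists (2 `^ r * (G * Num.max (K r) 0)).
    by do 2 (apply: mulr_ge0; first by rewrite // powR_ge0); rewrite le_max lexx orbT.
  move=> z B zB; rewrite -mulrA.
  have zq : carrier (ell q) z.
    by apply/ellP => //; eexists; exact: sum_le_pw_incl zB.
  apply: (sum_le_pw_lim (w := fun N => P N z)) => // [N s us|i]; last exact: cS.
  have B0 := sum_le_ge0 zB.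
  have KB0 : 0 <= Num.max (K r) 0 * B by rewrite mulr_ge0// le_max lexx orbT.
  apply: le_trans (ler_sum _ (fun i _ => weighted_sum_powR (fun j => T j z i) N r0)) _.
  rewrite exchange_big/= -[leRHS]mulrA.
  apply: (@le_trans _ _ (\sum_(0 <= j < N) c ^+ j.+1 * (Num.max (K r) 0 * B))).
    apply: ler_sum => j _; rewrite -mulr_sumr.
    have -> : (2^-1 ^+ j.+1) `^ r = c ^+ j.+1.
      rewrite -(@powR_mulrn _ 2^-1) ?invr_ge0// -powRrM mulrC powRrM.
      by rewrite powR_mulrn// powR_ge0.
    rewrite ler_wpM2l ?exprn_ge0 ?powR_ge0//.
    apply: le_trans (Tbd j r z B r0 rq zB s us) _.
    by rewrite ler_wpM2r// le_max lexx.
  by rewrite -mulr_suml ler_wpM2r// geometric_head.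
- move=> u uq u0 j i.
  have h := cS u i uq.
  have mono : nondecreasing_seq (fun N => P N u i).
    apply/nondecreasing_seqP => N; rewrite /P [leRHS]big_nat_recr//= lerDl.
    by rewrite mulr_ge0 ?exprn_ge0// Tpos.
  apply: le_trans (nondecreasing_cvgn_le mono _ j.+1); last by apply/cvg_ex; exists (S u i).
  rewrite /P big_nat_recr//= lerDr sumr_ge0// => k _.
  by rewrite mulr_ge0 ?exprn_ge0// Tpos.
Qed.

End SumOperator.

(** * Interpolation implies the S_q property *)

Section IntSq.
Context {R : realType}.
Implicit Types (u v x y z : nat -> R) (p q r V B : R) (E : seq_space R).

Definition unit_seq (n i : nat) : R := (i == n)%:R.

Lemma unit_seq_ell r n : 0 < r -> carrier (ell r) (unit_seq n).
Proof.
move=> r0; apply/ellP => //; exists 1; apply: (@sum_le_single _ _ n) => //.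
  by rewrite /pw /unit_seq eqxx normr1 powR1.
by move=> i /negPf ni; rewrite /pw /unit_seq ni normr0 powR0// gt_eqF.
Qed.

Lemma ell_abs q x : carrier (ell q) x -> carrier (ell q) (fun k => `|x k|).
Proof.
suff e : ell_norm q (fun k => `|x k|) = ell_norm q x by rewrite /= e.
rewrite /ell_norm; congr (_ `^ _)%E.
by apply: eq_eseriesr => k _; rewrite normr_id.
Qed.

Lemma lattice_abs E x : quasi_banach_lattice E -> carrier E x ->
  carrier E (fun k => `|x k|) /\ qnorm E (fun k => `|x k|) <= qnorm E x.
Proof. by move=> hE; apply: (qbl_solid hE) => k; rewrite normr_id. Qed.

Lemma carrier_scale E a x : quasi_banach E -> carrier E x -> carrier E (a *: x).
Proof.
by move=> qbE xE; have := qb_linear qbE a xE (qb_zero qbE); rewrite addr0.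
Qed.

Lemma carrier_add E x y : quasi_banach E -> carrier E x -> carrier E y ->
  carrier E (x + y).
Proof. by move=> qbE xE yE; have := qb_linear qbE 1 xE yE; rewrite scale1r. Qed.

Lemma carrier_sub E x y : quasi_banach E -> carrier E x -> carrier E y ->
  carrier E (x - y).
Proof.
move=> qbE xE yE; rewrite -scaleN1r; apply: carrier_add => //.
exact: carrier_scale.
Qed.

(** If no constant worked, each [j] would give a pair [(x j, y j)] violating the constant
    [4^(j+1) j], and an operator [T j] with [T j |x j| >= |y j|]. Their weighted sum is bounded on
    [E] by some [M]. Positivity of the operators and solidity of [E] transfer the bound from the sum
    to its terms, which is contradictory for [j >= M]. *)
Lemma Int_Sq p q E : 1 <= q -> 0 < p < q -> quasi_banach_lattice E ->
  Int p q E -> Sq_property q E.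
Proof.
move=> q1 /andP[p0 pq] hE [qbE [pE _] [Eq _] Tint]; have q0 : 0 < q by lra.
split=> //.
  move=> E0; have : carrier E (unit_seq 0) by apply: pE; exact: unit_seq_ell.
  rewrite E0 /= => /(congr1 (fun u => u 0%N)); rewrite /unit_seq eqxx.
  by move=> /eqP; rewrite oner_eq0.
apply: contrapT => H.
pose rel (xy : (nat -> R) * (nat -> R)) := [/\
  carrier E xy.1, carrier (ell q) xy.2,
  (\sum_(0 <= n <oo) (`|xy.1 n| `^ q)%:E =
   \sum_(0 <= n <oo) (`|xy.2 n| `^ q)%:E)%E &
  forall m : nat, \sum_(0 <= n < m) rearr xy.1 n `^ q <=
                  \sum_(0 <= n < m) rearr xy.2 n `^ q].
have /choice[xy xyP] : forall j : nat, exists xy, rel xy /\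
    ~ (carrier E xy.2 /\ qnorm E xy.2 <= (4 ^+ j.+1 * j%:R) * qnorm E xy.1).
  move=> j; apply: contrapT => Hj; apply: H.
  exists (4 ^+ j.+1 * j%:R) => x y xE yq e hd; apply: contrapT => Hn.
  by apply: Hj; exists (x, y); split.
pose x j := (xy j).1; pose y j := (xy j).2.
have /choice[T TP] : forall j, exists T : (nat -> R) -> (nat -> R), [/\
    forall a u v, T (a *: u + v) = a *: T u + T v,
    forall u, (forall i, 0 <= u i) -> forall i, 0 <= T u i,
    forall i, `|y j i| <= T (fun k => `|x j k|) i &
    forall r z B, 0 < r -> r <= q -> sum_le (pw r z) B ->
      sum_le (pw r (T z)) (block_const r * B)].
  move=> j; have [[xE yq e hd] _] := xyP j.
  have yV := ell_sum q0 yq.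
  apply: (block_operator q1 _ yV hd).
  apply/sums_toP; first exact: pw_ge0.
  by rewrite e; apply/sums_toP; [exact: pw_ge0|].
have [S [Slin Sbd Sdom]] := sum_operator q1
  (fun j => let: And4 h _ _ _ := TP j in h)
  (fun j => let: And4 _ h _ _ := TP j in h)
  (fun j => let: And4 _ _ _ h := TP j in h).
have [M hM] := Tint S Slin (Sbd q q0 (lexx q)) (Sbd p p0 (ltW pq)).
have [j Mj] : exists j : nat, M <= j%:R.
  exists (Num.bound `|M|); exact: le_trans (ler_norm _) (ltW (archi_boundP (normr_ge0 M))).
have [[xE yq _ _] []] := xyP j; rewrite -/(x j) -/(y j) in xE yq *.
have [_ _ yT _] := TP j.
have [axE axn] := lattice_abs hE xE.
have [SE Sn] := hM _ axE.
pose w := 4 ^+ j.+1 *: S (fun k => `|x j k|).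
have wE : carrier E w.
  exact: carrier_scale.
have yw k : `|y j k| <= `|w k|.
  apply: le_trans _ (ler_norm _).
  have := Sdom _ (ell_abs (Eq _ xE)) (fun i => normr_ge0 _) j k.
  rewrite exprVn mulrC ler_pdivrMr ?exprn_gt0// mulrC => h.
  by apply: le_trans (yT k) _; exact: h.
have [yE yn] := qbl_solid hE yw wE.
split=> //; apply: le_trans yn _.
rewrite (qb_homogeneous qbE)// ger0_norm ?exprn_ge0// -mulrA.
rewrite ler_wpM2l ?exprn_ge0//.
have n0 z : carrier E z -> 0 <= qnorm E z by exact: (qb_ge0 qbE).
apply: le_trans Sn _; apply: (@le_trans _ _ (j%:R * qnorm E (fun k => `|x j k|))).
  by rewrite ler_wpM2r// n0.
by rewrite ler_wpM2l.
Qed.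

End IntSq.

(** * Comparison of tails *)

Definition noninc {R : realType} (w : nat -> R) : Prop :=
  (forall i, 0 <= w i) /\ forall m n, (m <= n)%N -> w n <= w m.

Definition Sq_bound {R : realType} (q C : R) (E : seq_space R) : Prop :=
  forall x y : nat -> R,
    carrier E x -> carrier (ell q) y ->
    (\sum_(0 <= n <oo) (`|x n| `^ q)%:E = \sum_(0 <= n <oo) (`|y n| `^ q)%:E)%E ->
    (forall m : nat, \sum_(0 <= n < m) rearr x n `^ q <=
                     \sum_(0 <= n < m) rearr y n `^ q) ->
    carrier E y /\ qnorm E y <= C * qnorm E x.

Section Transfer.
Context {R : realType}.
Implicit Types (u v w x y z : nat -> R) (p q r t V B C : R) (E : seq_space R).

Lemma noninc_enum w : noninc w -> decr_enum (fun i => `|w i|) id.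
Proof.
move=> [w0 wm]; split => // [m n mn|i _]; last by exists i.
by rewrite !ger0_norm//; exact: wm.
Qed.

Lemma noninc_enum_pw q w : 0 < q -> noninc w -> decr_enum (pw q w) id.
Proof.
move=> q0 [w0 wm]; split => // [m n mn|i _]; last by exists i.
by rewrite pw_le// !ger0_norm//; exact: wm.
Qed.

Lemma noninc_scale t w : 0 <= t -> noninc w -> noninc (t *: w).
Proof.
by move=> t0 [w0 wm]; split=> [i|m n /wm h]; [exact: mulr_ge0|exact: ler_wpM2l].
Qed.

Lemma few0 A i : few A 0 -> ~~ A i.
Proof. by move=> h; apply/negP => Ai; have := h [:: i] isT; rewrite /= Ai => /(_ isT). Qed.

(** Removing [m] entries from [y] leaves at least its [m]-th tail, so the hypothesis compares the
    tails. The [S_q] condition also wants equal sums: the largest entry of [y] is raised, which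
    changes no tail but the whole sum. *)
Lemma Sq_transfer q C E w V y : 0 < q -> quasi_banach_lattice E -> Sq_bound q C E ->
  carrier E w -> noninc w -> sums_to (pw q w) V ->
  (forall m, exists2 A, few A m &
     sum_off_le A (pw q y) (V - headsum (pw q w) m)) ->
  carrier E y /\ qnorm E y <= C * qnorm E w.
Proof.
move=> q0 hE hC wE wn wV hA.
have yV : sum_le (pw q y) V.
  have [A fA h] := hA 0%N; move=> s us.
  have := h s us (fun i _ => few0 i fA).
  by rewrite /headsum big_geq// subr0.
have [U yU] := sums_to_ex (pw_ge0 q y) yV.
have UV : U <= V by apply: (proj2 yU).
have d0 : 0 <= V - U by rewrite subr_ge0.
have [s sE] := pw_enum_ex q0 yV.
have [si sm ss] := sE.
pose y' i := if i == s 0%N then (pw q y i + (V - U)) `^ q^-1 else `|y i|.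
have y'E i : pw q y' i = pw q y i + (i == s 0%N)%:R * (V - U).
  rewrite {1}/pw /y'; case: eqP => [->|_]; last by rewrite normr_id mul0r addr0.
  rewrite ger0_norm ?powR_ge0// powRVK// ?mul1r//.
  by rewrite addr_ge0// pw_ge0.
have y'V : sums_to (pw q y') V.
  have -> : pw q y' = (fun i => pw q y i + (i == s 0%N)%:R * (V - U)).
    by apply/funext.
  rewrite [X in sums_to _ X](_ : V = U + (V - U)); last by ring.
  apply: (sums_toD _ _ yU (sums_to_single _ d0)); first by move=> i; exact: pw_ge0.
  by move=> i; rewrite mulr_ge0.
have y'enum : decr_enum (pw q y') s.
  split=> // [m [|n] mn|i].
  - by move: mn; rewrite leqn0 => /eqP ->.
  - rewrite !y'E (_ : (s n.+1 == s 0%N) = false); last first.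
      by apply/eqP => /si.
    rewrite mul0r addr0; apply: le_trans (sm _ _ mn) _.
    by rewrite lerDl mulr_ge0.
  - rewrite y'E; have [->|_] := eqVneq i (s 0%N); first by exists 0%N.
    by rewrite mul0r addr0; exact: ss.
have y'q : carrier (ell q) y' by apply/ellP => //; exists V; exact: (proj1 y'V).
have [y'C y'n] : carrier E y' /\ qnorm E y' <= C * qnorm E w.
  apply: (hC w y' wE y'q (pw_series_eq wV y'V)) => m.
  rewrite [leLHS](rearr_heads m q0 (noninc_enum_pw q0 wn)).
  rewrite [leRHS](rearr_heads m q0 y'enum).
  rewrite -[pw q w \o id]/(pw q w).
  case: m => [|m]; first by rewrite /headsum !big_geq.
  have [A fA hAm] := hA m.+1.
  have := proj2 yU _ (decr_enum_tail (pw_ge0 q y) sE fA hAm).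
  have -> : headsum (pw q y' \o s) m.+1 = headsum (pw q y \o s) m.+1 + (V - U).
    rewrite /headsum !big_nat_recl//= y'E eqxx mul1r.
    rewrite (eq_bigr (fun i => pw q y (s i.+1))); first by ring.
    move=> i _; rewrite y'E (_ : (s i.+1 == s 0%N) = false) ?mul0r ?addr0//.
    by apply/eqP => /si.
  lra.
have yy' k : `|y k| <= `|y' k|.
  rewrite -(powR_leE q0)// -/(pw q y k) -/(pw q y' k) y'E lerDl.
  by rewrite mulr_ge0.
have [yE yn] := qbl_solid hE yy' y'C.
by split=> //; apply: le_trans yn _.
Qed.

End Transfer.

(** * Rearrangements, dilations and geometric series *)

Definition dil {R : realType} (w : nat -> R) (n : nat) : R := w n./2.

Section Consequences.
Context {R : realType}.
Implicit Types (u v w x y z : nat -> R) (p q r t V B C : R) (E : seq_space R).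

(** A sequence and its rearrangement have the same heads and the same sum. *)
Lemma Sq_rearr q C E x : 0 < q -> quasi_banach_lattice E -> Sq_bound q C E ->
  carrier E `<=` carrier (ell q) -> carrier E x ->
  exists s, [/\ decr_enum (pw q x) s, noninc (fun n => `|x (s n)|),
    carrier E (fun n => `|x (s n)|) &
    qnorm E (fun n => `|x (s n)|) <= C * qnorm E x].
Proof.
move=> q0 hE hC Eq xE; have xV := ell_sum q0 (Eq _ xE).
have [s sE] := pw_enum_ex q0 (proj1 xV).
have sE' := decr_enum_pw q0 sE.
have [si sm ss] := sE.
have wn : noninc (fun n => `|x (s n)|).
  by split=> // m n /sm; rewrite /pw powR_leE.
have wV : sums_to (pw q (fun n => `|x (s n)|)) (qnorm (ell q) x `^ q).
  have -> : pw q (fun n => `|x (s n)|) = pw q x \o s.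
    by apply/funext => n; rewrite /pw/= normr_id.
  exact: sums_to_reindex xV.
have [wE wC] : carrier E (fun n => `|x (s n)|) /\
    qnorm E (fun n => `|x (s n)|) <= C * qnorm E x.
  apply: (hC _ _ xE _ (pw_series_eq xV wV)) => [|m].
    by apply/ellP => //; eexists; exact: proj1 wV.
  apply: ler_of_eq; apply: eq_bigr => n _.
  by rewrite (rearr_enum _ sE') (rearr_enum _ (noninc_enum wn)) /= normr_id.
by exists s.
Qed.

Lemma unit_seq_noninc : noninc (@unit_seq R 0).
Proof.
split=> [i|m n mn]; rewrite /unit_seq//.
by rewrite ler_nat; case: m mn => [|m]; case: n.
Qed.

Lemma few1 j m : few (pred1 j) m.+1.
Proof.
move=> s us /allP h; apply: (@leq_trans (size [:: j])) => //.
by apply: uniq_leq_size us _ => i /h /=; rewrite inE.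
Qed.

Lemma quasi_const E : quasi_banach E -> exists2 K, 1 <= K &
  forall x y, carrier E x -> carrier E y ->
    qnorm E (x + y) <= K * (qnorm E x + qnorm E y).
Proof.
move=> qbE; have [K hK] := qb_quasi_triangle qbE.
exists (Num.max K 1); first by rewrite le_max lexx orbT.
move=> x y xE yE; apply: le_trans (hK _ _ xE yE) _.
by rewrite ler_wpM2r ?le_max ?lexx// addr_ge0 ?(qb_ge0 qbE).
Qed.

Lemma unit_seq_sums q j : 0 < q -> sums_to (pw q (@unit_seq R j)) 1.
Proof.
move=> q0; have -> : pw q (@unit_seq R j) = (fun i => (i == j)%:R * 1).
  apply/funext => i; rewrite /pw /unit_seq mulr1.
  by case: eqP => _; rewrite ?normr1 ?powR1// normr0 powR0// gt_eqF.
exact: sums_to_single.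
Qed.

(** The rearrangement of a nonzero element dominates a multiple of the unit sequence at [0], and the
    [S_q] condition does not see the position of a single nonzero entry. *)
Lemma Sq_unit_seq q C E j : 0 < q -> quasi_banach_lattice E -> Sq_bound q C E ->
  carrier E `<=` carrier (ell q) ->
  carrier E <> [set 0] -> carrier E (@unit_seq R j).
Proof.
move=> q0 hE hC Eq E0; have qbE := qbl_quasi_banach hE.
have [x [k xk] xE] : exists2 x, exists k, x k != 0 & carrier E x.
  apply: contrapT => H; apply: E0; apply/seteqP; split=> x /=; last first.
    by move=> ->; exact: qb_zero.
  move=> xE; apply/funext => k; apply: contrapT => /eqP xk; apply: H.
  by exists x => //; exists k.
have [s [sE [X0 Xm] XE _]] := Sq_rearr q0 hE hC Eq xE.
have [_ _ ss] := sE.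
have [n sn] : exists n, s n = k by apply: ss; rewrite powR_eq0r// normr_eq0.
have X0p : 0 < `|x (s 0%N)|.
  by apply: lt_le_trans (Xm _ _ (leq0n n)); rewrite sn normr_gt0.
have u0E : carrier E (@unit_seq R 0).
  have := carrier_scale (`|x (s 0%N)|^-1) qbE XE.
  apply: (fun h c => proj1 (qbl_solid hE h c)) => i.
  rewrite /unit_seq; have [->|_] := eqVneq i 0%N; last by rewrite normr0.
  by rewrite normr1 [X in _ <= `|X|]mulVf ?normr1// gt_eqF.
have wV := @unit_seq_sums q 0 q0.
apply: (proj1 (Sq_transfer q0 hE hC u0E unit_seq_noninc wV _)) => -[|m].
  exists pred0; first by move=> [|? ?].
  move=> t ut _; rewrite /headsum big_geq// subr0.
  exact: (proj1 (unit_seq_sums j q0)).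
exists (pred1 j); first exact: few1.
move=> t ut tj; rewrite big1_seq => [|i /= /tj /negPf ij].
  by rewrite subr_ge0; apply: sums_to_head wV => i; exact: pw_ge0.
by rewrite /pw /unit_seq (ij : (i == j) = false) normr0 powR0// gt_eqF.
Qed.

Lemma half_le n : (n./2 <= n)%N.
Proof. by rewrite -divn2 leq_div. Qed.

Lemma noninc_dil w : noninc w -> noninc (dil w).
Proof.
by move=> [w0 wm]; split=> [i|m n /half_leq/wm]; [exact: w0|].
Qed.

(** The copy of [w] on the indices of one parity has, after removal of the [m] places that carry the
    first terms, exactly the [m]-th tail of [w] left. *)
Lemma sum_spread q w V (b : bool) m : noninc w -> 0 < q -> sums_to (pw q w) V ->
  exists2 A, few A m & sum_off_le A
    (pw q (fun n => if odd n == b then dil w n else 0)) (V - headsum (pw q w) m).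
Proof.
move=> wn q0 wV.
have half_inj : {in [pred n | odd n == b] &, injective half}.
  move=> i k; rewrite !inE => /eqP bi /eqP bk e.
  by rewrite -(odd_double_half i) -(odd_double_half k) bi bk e.
exists [pred n | (odd n == b) && (n./2 < m)%N].
  move=> s us /allP sA; rewrite -(size_iota 0 m) -(size_map half s).
  apply: uniq_leq_size.
    rewrite map_inj_in_uniq// => i k /sA /andP[bi _] /sA /andP[bk _].
    exact: half_inj.
  by move=> _ /mapP[i /sA /andP[_ im] ->]; rewrite mem_iota.
move=> s us sA.
rewrite (bigID (fun n => odd n == b))/= [X in _ + X]big1 ?addr0; last first.
  by move=> i /negPf bi; rewrite /pw bi normr0 powR0// gt_eqF.
rewrite (eq_bigr (fun n => pw q w n./2)); last by move=> i bi; rewrite /pw bi.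
rewrite -big_filter -(big_map half xpredT (pw q w)).
apply: sum_le_tail => //; first by move=> i; exact: pw_ge0.
  rewrite map_inj_in_uniq ?filter_uniq// => i k.
  by rewrite !mem_filter => /andP[bi _] /andP[bk _]; exact: half_inj.
move=> _ /mapP[i + ->]; rewrite mem_filter => /andP[bi /sA /=].
by rewrite bi/= -leqNgt.
Qed.

(** The dilation is the sum of two copies of the sequence, spread over the even and over the odd
    indices, and [Sq_transfer] bounds each of them. *)
Lemma Sq_dil q C E : 0 < q -> quasi_banach_lattice E -> Sq_bound q C E ->
  carrier E `<=` carrier (ell q) ->
  exists2 A, 0 <= A & forall w, carrier E w -> noninc w ->
    carrier E (dil w) /\ qnorm E (dil w) <= A * qnorm E w.
Proof.
move=> q0 hE hC Eq; have qbE := qbl_quasi_banach hE.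
have [K K1 hK] := quasi_const qbE.
exists (K * (Num.max C 0 + Num.max C 0)).
  by rewrite mulr_ge0 ?addr_ge0 ?le_max ?lexx ?orbT// (le_trans ler01).
move=> w wE wn; have wV := ell_sum q0 (Eq _ wE).
pose y b n := if odd n == b then dil w n else 0.
have yE b : carrier E (y b) /\ qnorm E (y b) <= Num.max C 0 * qnorm E w.
  have [yE yn] := Sq_transfer q0 hE hC wE wn wV (fun m => sum_spread b m wn q0 wV).
  split=> //; apply: le_trans yn _; rewrite ler_wpM2r ?(qb_ge0 qbE)//.
  by rewrite le_max lexx.
have -> : dil w = y true + y false.
  apply/funext => n; rewrite [RHS](_ : _ = y true n + y false n)// /y.
  by case: (odd n); rewrite /= ?addr0 ?add0r.
have [y1 n1] := yE true; have [y2 n2] := yE false.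
split; first exact: carrier_add.
apply: le_trans (hK _ _ y1 y2) _; rewrite -mulrA ler_wpM2l ?(le_trans ler01)//.
by rewrite mulrDl lerD.
Qed.

Lemma carrier_sum E (u : nat -> nat -> R) m n : quasi_banach E ->
  (forall j, carrier E (u j)) -> carrier E (\sum_(m <= j < n) u j).
Proof.
move=> qbE uE; apply: big_ind => //; first exact: qb_zero.
by move=> x y; exact: carrier_add.
Qed.

Lemma qnorm0 E : quasi_banach E -> qnorm E 0 = 0.
Proof.
move=> qbE; rewrite -[X in qnorm E X](scale0r (0 : nat -> R)).
by rewrite (qb_homogeneous qbE) ?normr0 ?mul0r//; exact: qb_zero.
Qed.

Lemma unit_seq_qnorm_gt0 E k : quasi_banach E -> carrier E (@unit_seq R k) ->
  0 < qnorm E (@unit_seq R k).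
Proof.
move=> qbE kE; rewrite lt_neqAle (qb_ge0 qbE)// andbT eq_sym.
apply/eqP => /(qb_eq0 qbE kE) /(congr1 (fun f => f k)) /eqP.
by rewrite /unit_seq eqxx (_ : (0 : nat -> R) k = 0)// oner_eq0.
Qed.

Lemma qnormB E x y : quasi_banach E -> carrier E (x - y) ->
  qnorm E (y - x) = qnorm E (x - y).
Proof.
move=> qbE h; rewrite -opprB -scaleN1r (qb_homogeneous qbE)//.
by rewrite normrN normr1 mul1r.
Qed.

(** Geometric decay with ratio at most [1 / (2 K)] outweighs the powers of [K] which the
    quasi-triangle inequality produces. The limit in [E] is the pointwise sum because the
    coordinates are continuous on a lattice that contains the unit sequences. *)
Lemma geometric_series_in E K rho N (u : nat -> nat -> R) z :
  quasi_banach_lattice E ->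
  (forall k, carrier E (@unit_seq R k)) ->
  1 <= K -> (forall x y, carrier E x -> carrier E y ->
    qnorm E (x + y) <= K * (qnorm E x + qnorm E y)) ->
  0 <= rho -> 2 * K * rho <= 1 -> 0 <= N ->
  (forall j, carrier E (u j)) -> (forall j, qnorm E (u j) <= rho ^+ j * N) ->
  (forall i, \sum_(0 <= j < n) u j i @[n --> \oo] --> z i) ->
  carrier E z /\ qnorm E z <= 2 * K ^+ 2 * N.
Proof.
move=> hE unitE K1 hK rho0 Krho N0 uE un uz.
have qbE := qbl_quasi_banach hE.
have K0 : 0 < K by lra.
pose P n := \sum_(0 <= j < n) u j.
have PE n : carrier E (P n) by exact: carrier_sum.
(* peel off the first term: [K (1 + 2 K rho) <= 2 K] *)
have bd l m : qnorm E (\sum_(m <= j < m + l) u j) <= 2 * K * (rho ^+ m * N).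
  elim: l m => [|l IH] m.
    rewrite addn0 big_geq// (qnorm0 qbE).
    by rewrite !mulr_ge0 ?exprn_ge0// ltW.
  rewrite big_ltn ?addnS ?ltnS ?leq_addr//.
  apply: le_trans (hK _ _ (uE _) (carrier_sum _ _ qbE uE)) _.
  have h1 := un m; have h2 := IH m.+1; rewrite addSn exprS in h2.
  rewrite -mulrA mulrCA ler_wpM2l ?(ltW K0)//.
  set a := rho ^+ m * N in h1 *.
  have a0 : 0 <= a by rewrite mulr_ge0 ?exprn_ge0.
  have : 2 * K * rho * a <= 1 * a by rewrite ler_wpM2r.
  move: h1 h2; rewrite -(mulrA rho) -/a; set X := qnorm _ _; set Y := qnorm _ _.
  rewrite -!mulrA; lra.
have rho1 : `|rho| < 1.
  rewrite ger0_norm//; nra.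
have dist m n : (m <= n)%N -> qnorm E (P n - P m) <= 2 * K * (rho ^+ m * N).
  move=> mn; rewrite /P (big_cat_nat (leq0n m) mn)/= addrAC subrr add0r.
  by rewrite -{1}(subnKC mn); exact: bd.
have BE n m : carrier E (P n - P m).
  exact: carrier_sub.
have [v vE vlim] : exists2 v, carrier E v & qnorm E (P n - v) @[n --> \oo] --> (0 : R).
  apply: (qb_complete qbE) => // e e0.
  have : geometric (2 * K * N) rho n @[n --> \oo] --> (0 : R) by exact: cvg_geometric.
  move=> /cvgrPdist_lt/(_ _ e0)[M _ hM]; exists M.
  have small m n : (M <= m)%N -> (m <= n)%N -> qnorm E (P n - P m) < e.
    move=> Mm mn; apply: le_lt_trans (dist _ _ mn) _.
    have := hM m Mm; rewrite /geometric/= sub0r normrN.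
    rewrite (mulrC (rho ^+ m)) mulrA; exact: le_lt_trans (ler_norm _).
  move=> m n Mm Mn; have [mn|/ltnW nm] := leqP m n; last exact: small.
  by rewrite qnormB//; exact: small.
have vz : v = z.
  apply/funext => k; have unit_gt0 := unit_seq_qnorm_gt0 qbE (unitE k).
  have DE n : carrier E (P n - v).
    exact: carrier_sub.
  have coord n : `|P n k - v k| <= qnorm E (P n - v) / qnorm E (@unit_seq R k).
    rewrite ler_pdivlMr// -(qb_homogeneous qbE)//.
    apply: (proj2 (qbl_solid hE _ (DE n))) => i.
    rewrite [X in `|X| <= _](_ : _ = (P n k - v k) * (i == k)%:R)//.
    by case: eqP => [->|_]; rewrite ?mulr1// mulr0 normr0.
  have Pv : P n k @[n --> \oo] --> v k.
    apply/cvgrPdist_le => e e0.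
    have e0' : 0 < e * qnorm E (@unit_seq R k) by rewrite mulr_gt0.
    have /cvgrPdist_le/(_ _ e0')[M _ hM] := vlim; exists M => // n Mn.
    rewrite /= distrC; apply: le_trans (coord n) _; rewrite ler_pdivrMr//.
    have := hM n Mn; rewrite /= sub0r normrN; exact: le_trans (ler_norm _).
  apply: (cvg_unique _ Pv) => //.
  have -> : (fun n => P n k) = (fun n => \sum_(0 <= j < n) u j k).
    by apply/funext => n; rewrite /P fct_sumE.
  exact: uz.
rewrite -vz; split=> //; apply/ler_addgt0Pr => e e0.
have e0' : 0 < e / K by rewrite divr_gt0.
have /cvgrPdist_le/(_ _ e0')[M _ hM] := vlim.
have vP : carrier E (v - P M).
  exact: carrier_sub.
have : qnorm E (v - P M) <= e / K.
  rewrite (qnormB qbE); last exact: carrier_sub.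
  have := hM M (leqnn M); rewrite /= sub0r normrN; exact: le_trans (ler_norm _).
have := hK _ _ vP (PE M); rewrite subrK => h1 h2.
have h3 := bd M 0%N; rewrite add0n expr0 mul1r -/(P M) in h3.
apply: le_trans h1 _.
apply: (@le_trans _ _ (K * (e / K + 2 * K * N))).
  by rewrite ler_wpM2l ?(ltW K0)// lerD.
apply: ler_of_eq; field.
by rewrite gt_eqF.
Qed.

End Consequences.

(** * Means of the largest entries *)

Section Smear.
Context {R : realType}.
Implicit Types (u v w x y z : nat -> R) (p q r t V B C : R) (E : seq_space R).

Lemma noninc_dil_iter w j : noninc w -> noninc (fun n => w (n %/ 2 ^ j)%N).
Proof. by move=> [w0 wm]; split=> // m n mn; apply: wm; exact: leq_div2r. Qed.

(** [z] is the sum of the dilations [w (n %/ 2 ^ j)] with weights [2 ^ (- a j)]; the exponent [a] is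
    chosen so large that the weights beat the norms of the iterated dilations. *)
Lemma Sq_smear q C E : 0 < q -> quasi_banach_lattice E -> Sq_bound q C E ->
  carrier E `<=` carrier (ell q) -> carrier E <> [set 0] ->
  exists2 a : nat, (0 < a)%N & exists2 D : R, 0 <= D &
    forall w, carrier E w -> noninc w -> exists z, [/\ noninc z, carrier E z,
      qnorm E z <= D * qnorm E w &
      forall j n, w (n %/ 2 ^ j)%N <= 2 ^+ (a * j) * z n].
Proof.
move=> q0 hE hC Eq E0; have qbE := qbl_quasi_banach hE.
have [K K1 hK] := quasi_const qbE.
have [A A0 hA] := Sq_dil q0 hE hC Eq.
pose M := 2 * K * A; have M0 : 0 <= M by rewrite !mulr_ge0// (le_trans ler01).
pose a := (Num.bound M).+1.
have aM : M <= 2 ^+ a.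
  apply: le_trans (ltW (archi_boundP M0)) _.
  by rewrite -natrX ler_nat ltnW// (leq_trans (ltn_expl _ (ltnSn 1)))// leq_exp2l.
pose th : R := 2^-1 ^+ a.
have th0 : 0 < th by rewrite exprn_gt0// invr_gt0.
have thE : 2 ^+ a * th = 1 by rewrite /th exprVn divff// gt_eqF// exprn_gt0.
have th2 : th <= 2^-1.
  rewrite /th /a exprS ger_pMr ?invr_gt0// exprn_ile1// ?invr_ge0//.
  by rewrite invf_le1// ler1n.
clearbody th; exists a => //; exists (2 * K ^+ 2).
  by rewrite mulr_ge0// exprn_ge0// (le_trans ler01).
move=> w wE wn; have [w0 wm] := wn.
pose u j : nat -> R := th ^+ j *: (fun n => w (n %/ 2 ^ j)%N).
have uj j n : u j n = th ^+ j * w (n %/ 2 ^ j)%N by [].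
have u0 j n : 0 <= u j n by rewrite uj mulr_ge0// exprn_ge0// ltW.
have dE j : carrier E (fun n => w (n %/ 2 ^ j)%N) /\
    qnorm E (fun n => w (n %/ 2 ^ j)%N) <= A ^+ j * qnorm E w.
  elim: j => [|j [IHE IHn]].
    by rewrite (_ : (fun n => w (n %/ 2 ^ 0)%N) = w) ?mul1r//; apply/funext => n; rewrite divn1.
  rewrite (_ : (fun n => w (n %/ 2 ^ j.+1)%N) = dil (fun n => w (n %/ 2 ^ j)%N)); last first.
    by apply/funext => n; rewrite /dil -divn2 -divnMA expnS.
  have [h1 h2] := hA _ IHE (noninc_dil_iter j wn).
  by split=> //; apply: le_trans h2 _; rewrite exprS -mulrA ler_wpM2l.
have uE j : carrier E (u j) by apply: carrier_scale => //; have [] := dE j.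
have un j : qnorm E (u j) <= (th * A) ^+ j * qnorm E w.
  have [h1 h2] := dE j; rewrite (qb_homogeneous qbE)// ger0_norm ?exprn_ge0 ?(ltW th0)//.
  by rewrite exprMn -mulrA ler_wpM2l// exprn_ge0// ltW.
pose P n N : R := \sum_(0 <= j < N) u j n.
have Pm n : nondecreasing_seq (P n).
  by apply/nondecreasing_seqP => N; rewrite /P [leRHS]big_nat_recr//= lerDl.
have Pc n : cvgn (P n).
  apply: nondecreasing_is_cvgn => //; exists (2 * w 0%N) => _ [N _ <-].
  apply: (@le_trans _ _ (\sum_(0 <= j < N) 2^-1 ^+ j.+1 * (2 * w 0%N))).
    apply: ler_sum => j _; rewrite uj exprS.
    apply: (@le_trans _ _ (2^-1 ^+ j * w 0%N)); last by apply: ler_of_eq; field.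
    apply: ler_pM => //; first by rewrite exprn_ge0// ltW.
      by rewrite lerXn2r// nnegrE ?ltW// invr_gt0.
    exact: wm.
  by rewrite -mulr_suml -[leRHS]mul1r ler_wpM2r ?mulr_ge0// half_geometric_head.
pose z n := limn (P n).
have Pz n N : P n N <= z n by apply: nondecreasing_cvgn_le.
have uz j n : u j n <= z n.
  by apply: le_trans (Pz n j.+1); rewrite /P big_nat_recr//= lerDr sumr_ge0.
have zn : noninc z.
  split=> [i|m n mn]; first exact: le_trans (u0 0%N i) (uz 0%N i).
  apply: ler_lim => //; apply: nearW => N; apply: ler_sum => j _.
  rewrite !uj ler_wpM2l ?exprn_ge0 ?(ltW th0)//.
  by apply: wm; exact: leq_div2r.
have [zE zB] : carrier E z /\ qnorm E z <= 2 * K ^+ 2 * qnorm E w.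
  apply: (geometric_series_in hE _ K1 hK _ _ (qb_ge0 qbE wE) uE un).
  - by move=> k; exact: (Sq_unit_seq k q0 hE hC Eq E0).
  - by rewrite mulr_ge0// ltW.
  - have := ler_wpM2r (ltW th0) aM; rewrite thE /M; lra.
  - by move=> i; exact: Pc.
exists z; split=> // j n.
have e : (2 ^+ a) ^+ j * th ^+ j = 1 by rewrite -exprMn thE expr1n.
rewrite exprM -[leLHS]mul1r -[X in X * _]e -mulrA ler_wpM2l ?exprn_ge0//.
exact: uz.
Qed.

Lemma inv_sqrt_sum m : \sum_(0 <= n < m) (Num.sqrt n.+1%:R)^-1 <= 2 * Num.sqrt m%:R :> R.
Proof.
elim: m => [|m IH]; first by rewrite big_geq// sqrtr0 mulr0.
rewrite big_nat_recr//=; apply: le_trans (lerD IH (lexx _)) _.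
set s := Num.sqrt m%:R; set t := Num.sqrt m.+1%:R.
have t0 : 0 < t by rewrite sqrtr_gt0 ltr0n.
have ts : t ^+ 2 = s ^+ 2 + 1 by rewrite !sqr_sqrtr// -natr1.
rewrite -lerBrDl -(ler_pM2r t0) mulVf ?gt_eqF//.
have := sqr_ge0 (t - s); nra.
Qed.

(** If [j] is least with [m < (n + 1) 2 ^ j], then [w n <= 2 ^ (a j) z m] and
    [2 ^ j <= 2 m / (n + 1)]. Since [a p = 1 / 2], the [p]-th powers are at most
    [sqrt (2 m / (n + 1)) (z m) ^ p], and inverse square roots sum to [2 sqrt m]. *)
Lemma smear_head (a : nat) p w z m : (0 < a)%N -> p = (2 * a%:R)^-1 -> noninc w ->
  noninc z -> (forall j n, w (n %/ 2 ^ j)%N <= 2 ^+ (a * j) * z n) -> (0 < m)%N ->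
  headsum (pw p w) m <= m%:R * (4 * z m `^ p).
Proof.
move=> a0 pE [w0 wm] [z0 zm] wz m0.
have ap : a%:R * p = 2^-1 by rewrite pE; field; rewrite pnatr_eq0 -lt0n.
have p0 : 0 < p by rewrite pE invr_gt0 mulr_gt0// ltr0n.
apply: (@le_trans _ _ (\sum_(0 <= n < m) (Num.sqrt n.+1%:R)^-1 *
    (2 * Num.sqrt m%:R * z m `^ p))); last first.
  rewrite -mulr_suml; apply: le_trans (ler_wpM2r _ (inv_sqrt_sum m)) _.
    by rewrite !mulr_ge0// ?sqrtr_ge0 ?powR_ge0.
  have -> : m%:R = Num.sqrt m%:R * Num.sqrt m%:R :> R by rewrite -expr2 sqr_sqrtr.
  apply: ler_of_eq.
  by rewrite -expr2 sqr_sqrtr// -[in X in _ = X](@sqr_sqrtr _ m%:R)//; ring.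
apply: ler_sum_nat => n /andP[_ nm].
have ex : exists j, (m < n.+1 * 2 ^ j)%N.
  exists m; apply: (leq_trans (ltn_expl m (ltnSn 1))).
  by rewrite leq_pmull.
case: (ex_minnP ex) => -[|j] mj jmin.
  by move: mj; rewrite expn0 muln1 ltnS leqNgt nm.
have jm : (n.+1 * 2 ^ j <= m)%N by rewrite leqNgt; apply/negP => /jmin; rewrite ltnn.
have wn : w n <= 2 ^+ (a * j.+1) * z m.
  by apply: le_trans (wz j.+1 m); apply: wm; rewrite -ltnS ltn_divLR// expn_gt0.
have : pw p w n <= (2 ^+ (a * j.+1) * z m) `^ p.
  by rewrite /pw ger0_norm// powR_leE// mulr_ge0// exprn_ge0.
move=> /le_trans; apply.
rewrite powRM ?exprn_ge0// mulrA ler_wpM2r ?powR_ge0//.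
rewrite mulnC exprM -powR_mulrn ?exprn_ge0// -powRrM ap powR12_sqrt ?exprn_ge0//.
have sn0 : 0 < Num.sqrt n.+1%:R :> R by rewrite sqrtr_gt0 ltr0n.
rewrite mulrC ler_pdivlMr// -sqrtrM ?exprn_ge0//.
have -> : 2 * Num.sqrt m%:R = Num.sqrt (4 * m%:R) :> R.
  by rewrite sqrtrM// (_ : 4 = 2 ^+ 2) ?sqrtr_sqr ?normr_nat//; ring.
apply: ler_wsqrtr; rewrite -!natrX -!natrM ler_nat.
by rewrite expnS; nia.
Qed.

(** The terms of the dilation with indices from [m] to [2 m - 1] are all at least [z m]. *)
Lemma dil_tail q z V m : 0 < q -> noninc z -> sums_to (pw q (dil z)) V ->
  m%:R * z m `^ q <= V - headsum (pw q (dil z)) m.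
Proof.
move=> q0 [z0 zm] hV.
have := @sum_le_tail _ (pw q (dil z)) V m (index_iota m (m + m)) (pw_ge0 _ _) hV.
move=> /(_ (iota_uniq _ _)) h; apply: le_trans (h _); last first.
  by move=> i; rewrite mem_index_iota => /andP[].
have -> : m%:R * z m `^ q = \sum_(m <= i < m + m) z m `^ q.
  by rewrite sumr_const_nat addnK mulr_natl.
apply: ler_sum_nat => i /andP[_ im].
rewrite /pw /dil ger0_norm// powR_leE//; apply: zm.
by move: im; lia.
Qed.

(** Chebyshev's inequality: at most [m] entries exceed [t], and the others are so small that
    their [q]-th powers are controlled by the [p]-th powers. *)
Lemma weak_off p q v t m : 0 < p -> p < q -> 0 <= t ->
  sum_le (pw p v) (m%:R * t `^ p) ->
  exists2 A, few A m & sum_off_le A (pw q v) (m%:R * t `^ q).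
Proof.
move=> p0 pq t0 h; exists [pred n | t < `|v n|].
  move=> s us /allP sA.
  have [te|tn] := eqVneq t 0.
    case: s us sA => // n s us sA; have := sum_le_term n h.
    rewrite te powR0 ?gt_eqF// mulr0 => vn.
    have := sA n (mem_head _ _); rewrite /= te => vp.
    by move: vn; rewrite leNgt powR_gt0.
  have tp : 0 < t by rewrite lt_neqAle eq_sym tn.
  rewrite -(ler_nat R) -(ler_pM2r (powR_gt0 p tp)); apply: le_trans (h s us).
  have -> : (size s)%:R * t `^ p = \sum_(i <- s) t `^ p.
    by rewrite big_const_seq count_predT iter_addr_0 mulr_natl.
  rewrite !big_seq; apply: ler_sum => i /sA /=.
  by rewrite /pw powR_leE// => /ltW.
move=> s us sA; have E (c : R) := powR_split c p0 (ltW pq).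
rewrite E mulrCA; apply: le_trans (ler_wpM2l (powR_ge0 _ _) (h s us)).
rewrite mulr_sumr !big_seq; apply: ler_sum => i /sA /=; rewrite -leNgt => vt.
rewrite /pw E ler_wpM2r ?powR_ge0//.
by rewrite powR_leE// subr_gt0.
Qed.

End Smear.

(** * The S_q property implies interpolation *)

Section SqInt.
Context {R : realType}.
Implicit Types (u v w x y z : nat -> R) (p q r t V B C : R) (E : seq_space R).

(** Off [m] places the sum of [q]-th powers of [v1] is at most [m (L z_m)^q], hence at most [L^q]
    times the [m]-th tail of [dil z], like that of [v2]. The factor [4] absorbs two constants: the
    [2^q] of adding [v1] and [v2], and the [2 <= 2^q] of adding the two bounds. *)
Lemma Sq_split_transfer p q C E z V y L : 0 < p -> p < q -> 1 <= q ->
  quasi_banach_lattice E -> Sq_bound q C E -> noninc z -> carrier E (dil z) ->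
  sums_to (pw q (dil z)) V -> 0 <= L -> sum_le (pw q y) (L `^ q * V) ->
  (forall m, (0 < m)%N -> exists v1 v2, [/\ y = v1 + v2,
     sum_le (pw p v1) (m%:R * (L * z m) `^ p) &
     sum_le (pw q v2) (L `^ q * (V - headsum (pw q (dil z)) m))]) ->
  carrier E y /\ qnorm E y <= C * (4 * L * qnorm E (dil z)).
Proof.
move=> p0 pq q1 hE hC zn DE DV L0 yV ym; have q0 : 0 < q by lra.
have qbE := qbl_quasi_banach hE; have [z0 zm] := zn.
pose w := (4 * L) *: dil z.
have L4 : 0 <= 4 * L by rewrite mulr_ge0.
have wE : carrier E w by exact: carrier_scale.
have wn : noninc w := noninc_scale L4 (noninc_dil zn).
have wV := sums_to_pwZ L4 DV.
have wh m : headsum (pw q w) m = (4 * L) `^ q * headsum (pw q (dil z)) m.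
  by rewrite /headsum mulr_sumr; apply: eq_bigr => i _; rewrite pwZ ger0_norm.
have four : 2 `^ q * 2 <= 4 `^ q :> R.
  have -> : 4 = 2 * 2 :> R by ring.
  by rewrite powRM// ler_wpM2l ?powR_ge0// le1r_powR// ler1n.
have V0 : 0 <= V by exact: sum_le_ge0 (proj1 DV).
have [yE yn] : carrier E y /\ qnorm E y <= C * qnorm E w.
  apply: (Sq_transfer q0 hE hC wE wn wV) => -[|m].
    exists pred0; first by move=> [|? ?].
    move=> s us _; rewrite /headsum big_geq// subr0; apply: le_trans (yV s us) _.
    by rewrite ler_wpM2r// powR_leE//; lra.
  have [v1 [v2 [-> h1 h2]]] := ym m.+1 isT.
  have [A fA hA] := weak_off p0 pq (mulr_ge0 L0 (z0 m.+1)) h1.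
  exists A => // s us sA; rewrite wh -mulrBr powRM//.
  set tl := V - _ in h2 *.
  have dt : m.+1%:R * z m.+1 `^ q <= tl by exact: dil_tail.
  have tl0 : 0 <= tl by apply: le_trans dt; rewrite mulr_ge0 ?powR_ge0.
  apply: (@le_trans _ _ (2 `^ q * (L `^ q * tl + L `^ q * tl))).
    apply: (@le_trans _ _ (\sum_(i <- s) 2 `^ q * (pw q v1 i + pw q v2 i))).
      by apply: ler_sum => i _; exact: powR_normD.
    rewrite -mulr_sumr big_split ler_wpM2l ?powR_ge0//; apply: lerD.
      apply: le_trans (hA s us sA) _.
      by rewrite powRM// mulrCA ler_wpM2l ?powR_ge0.
    exact: h2.
  have := ler_wpM2r (mulr_ge0 (powR_ge0 L q) tl0) four; lra.
split=> //; apply: le_trans yn _.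
by rewrite (qb_homogeneous qbE)// ger0_norm.
Qed.

Lemma bounded_continuous_inclusion E F M :
  (forall x y, carrier E x -> carrier E y -> carrier E (y - x)) ->
  (forall x, carrier E x -> carrier F x /\ qnorm F x <= M * qnorm E x) ->
  (forall x, carrier E x -> 0 <= qnorm E x) ->
  continuous_inclusion E F.
Proof.
move=> Esub h E0; split=> [x /h[]//|x xE e e0].
have N0 : 0 < Num.max M 0 + 1 by rewrite ltr_wpDl// le_max lexx orbT.
exists (e / (Num.max M 0 + 1)) => [|y yE]; first by rewrite divr_gt0.
have yxE := Esub _ _ xE yE.
rewrite ltr_pdivlMr// => hy; apply: le_lt_trans hy.
apply: le_trans (proj2 (h _ yxE)) _; rewrite mulrC ler_wpM2l ?E0//.
by apply: ler_wpDr => //; rewrite le_max lexx.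
Qed.

(** All the mass of [x] concentrated in one entry majorises [x], so the [S_q] property applies to
    a multiple of a unit sequence. *)
Lemma Sq_norm_le q C E : 0 < q -> quasi_banach_lattice E -> Sq_bound q C E ->
  carrier E `<=` carrier (ell q) -> carrier E <> [set 0] ->
  exists M, forall x, carrier E x -> qnorm (ell q) x <= M * qnorm E x.
Proof.
move=> q0 hE hC Eq E0; have qbE := qbl_quasi_banach hE.
have eE := Sq_unit_seq 0 q0 hE hC Eq E0.
have e0 := unit_seq_qnorm_gt0 qbE eE.
exists (C / qnorm E (@unit_seq R 0)) => x xE.
have xV := ell_sum q0 (Eq _ xE).
set t := qnorm (ell q) x in xV *.
have t0 : 0 <= t by exact: qnorm_ell_ge0.
have wn : noninc (t *: @unit_seq R 0) := noninc_scale t0 unit_seq_noninc.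
have wV : sums_to (pw q (t *: @unit_seq R 0)) (t `^ q).
  by rewrite -[X in sums_to _ X]mulr1; exact: sums_to_pwZ t0 (unit_seq_sums _ q0).
have [_ ] : carrier E (t *: @unit_seq R 0) /\
    qnorm E (t *: @unit_seq R 0) <= C * qnorm E x.
  apply: (hC _ _ xE _ (pw_series_eq xV wV)) => [|m].
    by apply/ellP => //; eexists; exact: proj1 wV.
  have [s sE] := pw_enum_ex q0 (proj1 xV).
  have [si sm ss] := sE.
  rewrite [leLHS](rearr_heads m q0 sE).
  rewrite [leRHS](rearr_heads m q0 (noninc_enum_pw q0 wn)).
  case: m => [|m]; first by rewrite /headsum !big_geq.
  apply: (@le_trans _ _ (t `^ q)).
    apply: (sums_to_head m.+1 _ (sums_to_reindex si ss xV)) => i.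
    exact: pw_ge0.
  rewrite /headsum big_nat_recl//= pwZ ger0_norm// /pw /unit_seq eqxx normr1 powR1 mulr1.
  by rewrite lerDl sumr_ge0// => i _; exact: powR_ge0.
rewrite (qb_homogeneous qbE)// ger0_norm// => h.
by rewrite mulrAC ler_pdivlMr.
Qed.

Lemma Sq_Int q E : 1 <= q -> quasi_banach_lattice E -> Sq_property q E ->
  exists p, 0 < p < q /\ Int p q E.
Proof.
move=> q1 hE [E0 Eq [C' hC']]; have q0 : 0 < q by lra.
have qbE := qbl_quasi_banach hE.
pose C := Num.max C' 0; have C0 : 0 <= C by rewrite le_max lexx orbT.
have hC : Sq_bound q C E.
  move=> x y xE yq e hd; have [yE yn] := hC' x y xE yq e hd; split=> //.
  apply: le_trans yn _; rewrite ler_wpM2r ?(qb_ge0 qbE)//.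
  by rewrite le_max lexx.
have [a a0 [D D0 hD]] := Sq_smear q0 hE hC Eq E0.
have [A A0 hA] := Sq_dil q0 hE hC Eq.
pose p : R := (2 * a%:R)^-1.
have a1 : 1 <= a%:R :> R by rewrite ler1n.
have p0 : 0 < p by rewrite invr_gt0; lra.
have pq : p < q.
  apply: lt_le_trans q1; rewrite invf_lt1; lra.
exists p; split; first by rewrite p0.
split=> //.
- (* [x] in [l^p] is compared with the weighted sum [z] of the dilations of a unit sequence, for
     which [smear_head] says that [m * 4 (z m)^p] is at least [1] *)
  have [z [zn zE zB wz]] := hD _ (Sq_unit_seq 0 q0 hE hC Eq E0) (@unit_seq_noninc R).
  have [dE _] := hA _ zE zn; have dV := ell_sum q0 (Eq _ dE).
  have z1 m : (0 < m)%N -> 1 <= m%:R * (4 * z m `^ p).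
    move=> m0; apply: le_trans (smear_head a0 (erefl _) (@unit_seq_noninc R) zn wz m0).
    case: m m0 => // m _; rewrite /headsum big_nat_recl//.
    rewrite {1}/pw /unit_seq eqxx normr1 powR1 lerDl.
    by apply: sumr_ge0 => i _; exact: powR_ge0.
  have z01 : 1 <= z 0%N.
    by have := wz 0%N 0%N; rewrite muln0 expr0 mul1r div0n /unit_seq eqxx.
  apply: (@bounded_continuous_inclusion _ _ (C * (4 * 4 `^ p^-1 * qnorm E (dil z)))).
  + move=> x y /(ellP _ p0)[B xB] /(ellP _ p0)[B' yB']; apply/ellP => //.
    eexists; apply: sum_le_pwD => //; first exact: yB'.
    by apply: sum_le_mono xB => i; rewrite /pw normrN.
  + move=> x xp; have xN := proj1 (ell_sum p0 xp).
    set N := qnorm (ell p) x in xN *.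
    have N0 : 0 <= N by exact: qnorm_ell_ge0.
    pose L := 4 `^ p^-1 * N.
    have L0 : 0 <= L by rewrite mulr_ge0 ?powR_ge0.
    have [xE xn] : carrier E x /\ qnorm E x <= C * (4 * L * qnorm E (dil z)).
      apply: (Sq_split_transfer p0 pq q1 hE hC zn dE dV L0).
        apply: sum_le_trans (sum_le_pw_incl p0 (ltW pq) xN) _.
        rewrite powRK// -[leLHS]mulr1; apply: ler_pM; rewrite ?powR_ge0//.
          rewrite powR_leE// ler_peMl//.
          rewrite -(powR_leE p0) ?powR_ge0// powRVK// powR1.
          by rewrite ler1n.
        apply: le_trans (sum_le_term 0%N (proj1 dV)).
        rewrite /pw /dil/= ger0_norm ?(le_trans ler01)//.
        exact: le_trans z01 (le1r_powR z01 q1).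
      move=> m m0; exists x, 0; split; first by rewrite addr0.
        apply: sum_le_trans xN _; rewrite /L -mulrA powRM ?powR_ge0//; last first.
          by rewrite mulr_ge0// (proj1 zn).
        rewrite powRVK// powRM// ?(proj1 zn)//.
        have := ler_wpM2l (powR_ge0 N p) (z1 m m0); rewrite mulr1.
        by move/le_trans; apply; apply: ler_of_eq; ring.
      apply: (sum_le_mono (v := fun=> 0)) => [i|s _].
        by rewrite /pw normr0 powR0// gt_eqF.
      rewrite big1// mulr_ge0 ?powR_ge0// subr_ge0.
      by apply: sums_to_head dV => i; exact: pw_ge0.
    split=> //; apply: le_trans xn _.
    by apply: ler_of_eq; rewrite /L; ring.
  + by move=> x _; exact: qnorm_ell_ge0.
- have [M hM] := Sq_norm_le q0 hE hC Eq E0.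
  apply: (@bounded_continuous_inclusion _ _ M).
  + by move=> x y xE yE; exact: carrier_sub.
  + by move=> x xE; split; [exact: Eq|exact: hM].
  + exact: (qb_ge0 qbE).
- move=> T Tlin /(bounded_on_ellP _ q0)[Mq Mq0 Tq] /(bounded_on_ellP _ p0)[Mp Mp0 Tp].
  (* [L] serves both parts: [4 * Mp <= L ^ p] and [Mq <= L ^ q] *)
  pose L := (4 * Mp) `^ p^-1 + Mq `^ q^-1.
  have L0 : 0 <= L by rewrite addr_ge0 ?powR_ge0.
  exists (C * (4 * L * (A * (D * C)))) => x xE.
  have [U xV] : exists U, sums_to (pw q x) U.
    by eexists; exact: ell_sum q0 (Eq _ xE).
  have [s [sE Xn XE XB]] := Sq_rearr q0 hE hC Eq xE.
  have [si sm ss] := sE.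
  set X := (fun n => `|x (s n)|) in Xn XE XB.
  have XX r n : pw r X n = pw r x (s n) by rewrite /pw normr_id.
  have [z [zn zE zB wz]] := hD _ XE Xn.
  have [dE dB] := hA _ zE zn.
  have [V dV] : exists V, sums_to (pw q (dil z)) V.
    by eexists; exact: ell_sum q0 (Eq _ dE).
  have XV : sums_to (pw q X) U.
    have -> : pw q X = pw q x \o s by apply/funext => n; exact: XX.
    exact: sums_to_reindex xV.
  have Xd n : pw q X n <= pw q (dil z) n.
    have [z0 zm] := zn; have [X0 _] := Xn.
    rewrite pw_le// !ger0_norm ?X0//; last exact: z0.
    apply: (@le_trans _ _ (z n)); last by apply: zm; exact: half_le.
    by have := wz 0%N n; rewrite muln0 expr0 mul1r expn0 divn1.
  have tails m := tail_le m (pw_ge0 q X) Xd XV dV.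
  have LMq : Mq <= L `^ q.
    rewrite -{1}[Mq](powRVK q0)// powR_leE ?powR_ge0//.
    by rewrite lerDr powR_ge0.
  have LMp : 4 * Mp <= L `^ p.
    rewrite -{1}[4 * Mp](powRVK p0) ?mulr_ge0// powR_leE ?powR_ge0//.
    by rewrite lerDl powR_ge0.
  have [TE Tn] : carrier E (T x) /\ qnorm E (T x) <= C * (4 * L * qnorm E (dil z)).
    apply: (Sq_split_transfer p0 pq q1 hE hC zn dE dV L0).
      apply: sum_le_trans (Tq _ _ (proj1 xV)) _.
      apply: (ler_pM Mq0 (sum_le_ge0 (proj1 xV)) LMq).
      by have := tails 0%N; rewrite !headsum0 !subr0.
    (* [x1] keeps the [m] largest entries of [x], and [x2] the others *)
    move=> m m0; pose top i := i \in map s (iota 0 m).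
    have topE n : top (s n) = (n < m)%N by rewrite /top mem_map// mem_iota.
    pose x1 i := if top i then x i else 0.
    pose x2 i := if top i then 0 else x i.
    have x12 : x = x1 + x2.
      apply/funext => i; rewrite [RHS](_ : _ = x1 i + x2 i)// /x1 /x2.
      by case: ifP; rewrite ?addr0 ?add0r.
    have supp r (x' : nat -> R) i : 0 < r -> (forall i, x i = 0 -> x' i = 0) ->
        pw r x' i != 0 -> exists n, s n = i.
      move=> r0 hx' xi; apply: ss; apply: contraNneq xi => /eqP.
      rewrite powR_eq0r// normr_eq0 => /eqP /hx' e.
      by rewrite /pw e normr0 powR_eq0r.
    have h1 : sum_le (pw p x1) (headsum (pw p X) m).
      apply: (sum_le_supp (f := s)).
        by move=> i; apply: supp => // k xk; rewrite /x1 xk if_same.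
      move=> l ul; rewrite (bigID (fun n => (n < m)%N))/= [X in _ + X]big1 ?addr0; last first.
        by move=> n nm; rewrite /pw /x1 topE (negPf nm) normr0 powR0// gt_eqF.
      rewrite (eq_bigr (pw p X)); last by move=> n nm; rewrite XX /pw /x1 topE nm.
      rewrite -big_filter; apply: ler_sum_sub; rewrite ?filter_uniq ?iota_uniq//.
        by move=> i; exact: pw_ge0.
      by move=> n; rewrite mem_filter mem_index_iota => /andP[].
    have h2 : sum_le (pw q x2) (U - headsum (pw q X) m).
      apply: (sum_le_supp (f := s)).
        by move=> i; apply: supp => // k xk; rewrite /x2 xk if_same.
      move=> l ul; rewrite (bigID (fun n => (n < m)%N))/= big1 ?add0r; last first.
        by move=> n nm; rewrite /pw /x2 topE nm normr0 powR0// gt_eqF.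
      rewrite (eq_bigr (pw q X)); last first.
        by move=> n /negPf nm; rewrite XX /pw /x2 topE nm.
      rewrite -big_filter; apply: sum_le_tail; rewrite ?filter_uniq//.
        by move=> i; exact: pw_ge0.
      by move=> n; rewrite mem_filter -leqNgt => /andP[].
    have x1p := h1; have x1q := sum_le_pw_incl p0 (ltW pq) h1.
    exists (T x1), (T x2); split.
    + rewrite {1}x12 -[x1 in LHS]scale1r Tlin ?scale1r//.
        by apply/ellP => //; eexists; exact: x1q.
      by apply/ellP => //; eexists; exact: h2.
    + apply: sum_le_trans (Tp _ _ h1) _.
      have h := smear_head a0 (erefl _) Xn zn wz m0.
      apply: le_trans (ler_wpM2l Mp0 h) _.
      rewrite powRM ?(proj1 zn)//.
      have := ler_wpM2r (mulr_ge0 (ler0n R m) (powR_ge0 (z m) p)) LMp.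
      by move=> h3; rewrite [leRHS]mulrCA; apply: le_trans h3; apply: ler_of_eq; rewrite /p; ring.
    + apply: sum_le_trans (Tq _ _ h2) _.
      exact: (ler_pM Mq0 (sum_le_ge0 h2) LMq (tails m)).
  split=> //; apply: le_trans Tn _.
  rewrite -!mulrA !ler_wpM2l//.
  apply: le_trans dB _; rewrite ler_wpM2l//.
  by apply: le_trans zB _; rewrite ler_wpM2l.
Qed.

End SqInt.

Unset Implicit Arguments.

Theorem corollary6p3 (R : realType) (q : R) (hq : 1 <= q)
    (E : seq_space R) (hE : quasi_banach_lattice E) :
  Sq_property q E <-> exists p : R, 0 < p < q /\ Int p q E.
Proof.
split; first exact: Sq_Int.
by move=> [p [pq hI]]; exact: (Int_Sq hq pq hE hI).
Qed.
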